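(* Let $G=H+J$ be a finite group of triangular type. The system of characters $\{\chi_\alpha : \alpha\in\mathfrak A\}$ and the system of subsets $\{K_\beta : \beta\in\mathfrak B\}$ of $G$ form a supercharacter theory for the group $G$; that is, the characters $\chi_\alpha$ ($\alpha\in\mathfrak A$) are pairwise disjoint, the sets $K_\beta$ ($\beta\in\mathfrak B$) form a partition of $G$, $|\mathfrak A|=|\mathfrak B|$, each $\chi_\alpha$ is constant on each $K_\beta$, and $\{1\}$ is one of the sets $K_\beta$.
   Context: Setting. Let $k=\mathbb F_q$ be a finite field, $H$ a finite abelian group with $\mathrm{char}\,k\nmid |H|$, and $J$ a finite-dimensional nilpotent associative $k$-algebra with commuting $k$-linear left and right actions $(h,x)\mapsto hx$, $(h,x)\mapsto xh$ of $H$ on $J$ such that $h(xy)=(hx)y$, $(xy)h=x(yh)$, $x(hy)=(xh)y$ for all $h\in H$, $x,y\in J$. Then $A=kH\oplus J$ is an associative unital algebra with multiplication extending $(h_1+x_1)(h_2+x_2)=h_1h_2+h_1x_2+x_1h_2+x_1x_2$. The set $G=H+J=\{h+x: h\in H,x\in J\}\subset A$ is a finite group under this multiplication, called a finite group of triangular type. Put $N=1+J$. Action. $\widetilde G$ is the group of triples $\tau=(t,a,b)$, $t\in H$, $a,b\in N$, with product $(t_1,a_1,b_1)(t_2,a_2,b_2)=(t_1t_2,\ t_2^{-1}a_1t_2a_2,\ t_2^{-1}b_1t_2b_2)$. It acts on $J$ by $\rho(\tau)(x)=taxb^{-1}t^{-1}$ and on the dual space $J^*=\mathrm{Hom}_k(J,k)$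 by $(\rho^*(\tau)\lambda)(x)=\lambda(\rho(\tau^{-1})(x))$. For $\lambda\in J^*$, $c\in A$ write $(c\lambda)(x)=\lambda(xc)$, $(\lambda c)(x)=\lambda(cx)$. Idempotents. For an idempotent $e\in A$ ($e=0$ allowed) put $e'=1-e$, $A_e=eAe$, $J_e=eJe$; $J_e^*$ is identified with the set of $\lambda\in J^*$ vanishing on $eJe'$, $e'Je$, $e'Je'$. For an idempotent $e\in kH$ put $H_e=\{he:h\in H\}$ (a group with identity $e$), $N_e=e+J_e$, and let $\widetilde{G_e}$ be the group of triples $(t,a,b)$, $t\in H_e$, $a,b\in N_e$, with the same product formula, acting on $J_e$ by $x\mapsto taxb^{-1}t^{-1}$ (inverses in $G_e=H_e+J_e$) and on $J_e^*$ by the dual action. Put $H(e)=\{h\in H: he=e\}$. An element of $J_e$ (resp. $J_e^*$) is regular in $J_e$ (resp. $J_e^*$) if it does not lie in $J_f$ (resp. $J_f^*$) for any idempotent $f\in A_e$, $f\neq e$. A $\widetilde{G_e}$-orbit is regular if its elements are regular. Superclasses. $\widetilde G$ acts on $G$ by $R_\tau(g)=1+ta(g-1)b^{-1}t^{-1}$, $\tau=(t,a,b)$; the superclass $K(g)$ is the $\widetilde G$-orbit of $g$. $\mathfrak B$ is the set of triples $\beta=(e,h,\omega)$ with $e$ an idempotent in $kH$, $h\in H(e)$, and $\omega$ a regular $\widetilde{G_e}$-orbit in $J_e$; $K_\beta=K(h+y)$ for any $y\in\omega$ (independent of the choice of $y$). Supercharacters. $\mathfrak A$ is the set of triples $\alpha=(e,\theta,\omega^*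 )$ with $e$ an idempotent in $kH$, $\theta:H(e)\to\mathbb C^*$ a linear character, and $\omega^*$ a regular $\widetilde{G_e}$-orbit in $J_e^*$. Fix a nontrivial character $t\mapsto\varepsilon^t$ of the additive group of $\mathbb F_q$ with values in $\mathbb C^*$. For $\lambda\in\omega^*$ let $J_{\lambda,\mathrm{right}}=\{x\in J:\lambda x=0\}$, $G_\lambda=\{h+x: h\in H(e),\ x\in J_{\lambda,\mathrm{right}}\}$ (a subgroup of $G$), $\xi_{\theta,\lambda}(h+x)=\theta(h)\varepsilon^{\lambda(x)}$ (a linear character of $G_\lambda$), and $\chi_{\theta,\lambda}=\mathrm{ind}(\xi_{\theta,\lambda},G_\lambda,G)$, the induced character. Put $\chi_\alpha=\chi_{\theta,\lambda}$ for any $\lambda\in\omega^*$ (independent of the choice of $\lambda$). Characters are disjoint if they have no common irreducible constituent. A supercharacter theory of a finite group $G$ is a system of pairwise disjoint characters $\{\chi_\alpha\}_{\alpha\in\mathfrak A}$ together with a partition $\{K_\beta\}_{\beta\in\mathfrak B}$ of $G$ such that: S1) $|\mathfrak A|=|\mathfrak B|$; S2) each $\chi_\alpha$ is constant on each $K_\beta$; S3) $\{1\}$ is one of the $K_\beta$. *)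

(* Defs.v *)
From HB Require Import structures.
From mathcomp Require Import all_boot all_order all_algebra.
From mathcomp Require Import all_fingroup all_solvable all_field all_character.

Set Implicit Arguments.
Unset Strict Implicit.
Unset Printing Implicit Defensive.

Import GroupScope GRing.Theory.
Local Open Scope ring_scope.

(* Products of n.+1 elements of J vanish for some n: this is nilpotency of J. *)
Record triangular_data (k : finFieldType) (hT : finGroupType) :=
  TriangularData {
  td_abelian : abelian [set: hT];
  td_char : forall p : nat, p \in [pchar k] -> ~~ (p %| #|hT|)%N;
  td_J : vectType k;
  td_mul : td_J -> td_J -> td_J;
  td_lact : hT -> td_J -> td_J;
  td_ract : td_J -> hT -> td_J;
  td_mulA : associative td_mul;
  td_mulDl : left_distributive td_mul +%R;
  td_mulDr : right_distributive td_mul +%R;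
  td_mulZl : forall (c : k) x y, td_mul (c *: x) y = c *: td_mul x y;
  td_mulZr : forall (c : k) x y, td_mul x (c *: y) = c *: td_mul x y;
  td_nilpotent : exists n : nat, forall (x : td_J) (s : seq td_J),
    size s = n -> foldl td_mul x s = 0;
  td_lactP : forall (h : hT) (c : k) x y,
    td_lact h (c *: x + y) = c *: td_lact h x + td_lact h y;
  td_ractP : forall (h : hT) (c : k) x y,
    td_ract (c *: x + y) h = c *: td_ract x h + td_ract y h;
  td_lact1 : forall x, td_lact 1%g x = x;
  td_ract1 : forall x, td_ract x 1%g = x;
  td_lactM : forall h1 h2 x, td_lact (h1 * h2)%g x = td_lact h1 (td_lact h2 x);
  td_ractM : forall h1 h2 x, td_ract x (h1 * h2)%g = td_ract (td_ract x h1) h2;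
  td_lract : forall h1 h2 x,
    td_ract (td_lact h1 x) h2 = td_lact h1 (td_ract x h2);
  td_lact_mul : forall h x y, td_lact h (td_mul x y) = td_mul (td_lact h x) y;
  td_ract_mul : forall h x y, td_ract (td_mul x y) h = td_mul x (td_ract y h);
  td_mid : forall h x y, td_mul x (td_lact h y) = td_mul (td_ract x h) y
}.

Section Algebra.
Variables (k : finFieldType) (hT : finGroupType) (D : triangular_data k hT).

(* finvect_type makes the finite-dimensional k-space J a finType. *)
Definition triJ := finvect_type (td_J D).
HB.instance Definition _ := Vector.on triJ.
HB.instance Definition _ := Finite.on triJ.

Definition mulJ (x y : triJ) : triJ := td_mul x y.
Definition lact (a : {ffun hT -> k^o}) (x : triJ) : triJ :=
  \sum_h a h *: (td_lact h x : triJ).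
Definition ract (x : triJ) (a : {ffun hT -> k^o}) : triJ :=
  \sum_h a h *: (td_ract x h : triJ).

(* The algebra A = kH (+) J; kH is the space of functions on H with the
   convolution product. *)
Definition triA := ({ffun hT -> k^o} * triJ)%type.
HB.instance Definition _ := Finite.on triA.
HB.instance Definition _ := GRing.Lmodule.on triA.

Definition hA (h : hT) : triA := ([ffun g => (g == h)%:R], 0).
Definition jA (x : triJ) : triA := (0, x).
Definition conv (a b : {ffun hT -> k^o}) : {ffun hT -> k^o} :=
  [ffun g => \sum_h a h * b (h^-1 * g)%g].
Definition triA_one : triA := hA 1%g.
Definition triA_mul (u v : triA) : triA :=
  (conv u.1 v.1, lact u.1 v.2 + ract u.2 v.1 + mulJ u.2 v.2).


Lemma mulJA : associative mulJ. Proof. exact: td_mulA. Qed.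
Lemma mulJDl : left_distributive mulJ +%R. Proof. exact: td_mulDl. Qed.
Lemma mulJDr : right_distributive mulJ +%R. Proof. exact: td_mulDr. Qed.
Lemma mulJZl c x y : mulJ (c *: x) y = c *: mulJ x y.
Proof. exact: td_mulZl. Qed.
Lemma mulJZr c x y : mulJ x (c *: y) = c *: mulJ x y.
Proof. exact: td_mulZr. Qed.
Lemma mul0J x : mulJ 0 x = 0.
Proof. by apply: (addrI (mulJ 0 x)); rewrite -mulJDl !addr0. Qed.
Lemma mulJ0 x : mulJ x 0 = 0.
Proof. by apply: (addrI (mulJ x 0)); rewrite -mulJDr !addr0. Qed.

Definition lacth (h : hT) (x : triJ) : triJ := td_lact h x.
Definition racth (x : triJ) (h : hT) : triJ := td_ract x h.

Lemma lacthP h c x y : lacth h (c *: x + y) = c *: lacth h x + lacth h y.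
Proof. exact: td_lactP. Qed.
Lemma racthP h c x y : racth (c *: x + y) h = c *: racth x h + racth y h.
Proof. exact: td_ractP. Qed.
Lemma lacthD h x y : lacth h (x + y) = lacth h x + lacth h y.
Proof. by have := lacthP h 1 x y; rewrite !scale1r. Qed.
Lemma racthD h x y : racth (x + y) h = racth x h + racth y h.
Proof. by have := racthP h 1 x y; rewrite !scale1r. Qed.
Lemma lacth0 h : lacth h 0 = 0.
Proof. by apply: (addrI (lacth h 0)); rewrite -lacthD !addr0. Qed.
Lemma racth0 h : racth 0 h = 0.
Proof. by apply: (addrI (racth 0 h)); rewrite -racthD !addr0. Qed.
Lemma lacthZ h c x : lacth h (c *: x) = c *: lacth h x.
Proof. by have := lacthP h c x 0; rewrite !addr0 lacth0 addr0. Qed.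
Lemma racthZ h c x : racth (c *: x) h = c *: racth x h.
Proof. by have := racthP h c x 0; rewrite !addr0 racth0 addr0. Qed.
Lemma lacth_sum h (I : Type) (r : seq I) (P : pred I) F :
  lacth h (\sum_(i <- r | P i) F i) = \sum_(i <- r | P i) lacth h (F i).
Proof. by elim/big_rec2: _ => [|i y x _ <-]; rewrite ?lacth0 ?lacthD. Qed.
Lemma racth_sum h (I : Type) (r : seq I) (P : pred I) F :
  racth (\sum_(i <- r | P i) F i) h = \sum_(i <- r | P i) racth (F i) h.
Proof. by elim/big_rec2: _ => [|i y x _ <-]; rewrite ?racth0 ?racthD. Qed.
Lemma mulJ_suml (I : Type) (r : seq I) (P : pred I) F y :
  mulJ (\sum_(i <- r | P i) F i) y = \sum_(i <- r | P i) mulJ (F i) y.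
Proof. by elim/big_rec2: _ => [|i u v _ <-]; rewrite ?mul0J ?mulJDl. Qed.
Lemma mulJ_sumr (I : Type) (r : seq I) (P : pred I) F y :
  mulJ y (\sum_(i <- r | P i) F i) = \sum_(i <- r | P i) mulJ y (F i).
Proof. by elim/big_rec2: _ => [|i u v _ <-]; rewrite ?mulJ0 ?mulJDr. Qed.

Lemma lacth_mul h x y : lacth h (mulJ x y) = mulJ (lacth h x) y.
Proof. exact: td_lact_mul. Qed.
Lemma mulJ_midh h x y : mulJ x (lacth h y) = mulJ (racth x h) y.
Proof. exact: td_mid. Qed.

Lemma lactE a x : lact a x = \sum_h a h *: lacth h x. Proof. by []. Qed.
Lemma ractE a x : ract x a = \sum_h a h *: racth x h. Proof. by []. Qed.

Lemma lactDl a b x : lact (a + b) x = lact a x + lact b x.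
Proof.
by rewrite /lact -big_split; apply: eq_bigr => h _; rewrite ffunE scalerDl.
Qed.
Lemma lactDr a x y : lact a (x + y) = lact a x + lact a y.
Proof.
rewrite !lactE -big_split; apply: eq_bigr => h _.
by rewrite lacthD scalerDr.
Qed.
Lemma ractDr a b x : ract x (a + b) = ract x a + ract x b.
Proof.
by rewrite /ract -big_split; apply: eq_bigr => h _; rewrite ffunE scalerDl.
Qed.
Lemma ractDl a x y : ract (x + y) a = ract x a + ract y a.
Proof.
rewrite !ractE -big_split; apply: eq_bigr => h _.
by rewrite racthD scalerDr.
Qed.
Lemma lactZl c a x : lact (c *: a) x = c *: lact a x.
Proof.
by rewrite /lact scaler_sumr; apply: eq_bigr => h _; rewrite ffunE scalerA.
Qed.
Lemma ractZr c a x : ract x (c *: a) = c *: ract x a.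
Proof.
by rewrite /ract scaler_sumr; apply: eq_bigr => h _; rewrite ffunE scalerA.
Qed.
Lemma lactZr c a x : lact a (c *: x) = c *: lact a x.
Proof.
rewrite !lactE scaler_sumr; apply: eq_bigr => h _.
by rewrite lacthZ !scalerA mulrC.
Qed.
Lemma ractZl c a x : ract (c *: x) a = c *: ract x a.
Proof.
rewrite !ractE scaler_sumr; apply: eq_bigr => h _.
by rewrite racthZ !scalerA mulrC.
Qed.
Lemma lact0 a : lact a 0 = 0.
Proof. by apply: (addrI (lact a 0)); rewrite -lactDr !addr0. Qed.
Lemma lact0l x : lact 0 x = 0.
Proof. by apply: (addrI (lact 0 x)); rewrite -lactDl !addr0. Qed.
Lemma ract0 a : ract 0 a = 0.
Proof. by apply: (addrI (ract 0 a)); rewrite -ractDl !addr0. Qed.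
Lemma ract0r x : ract x 0 = 0.
Proof. by apply: (addrI (ract x 0)); rewrite -ractDr !addr0. Qed.

Lemma lact_hA h x : lact (hA h).1 x = lacth h x.
Proof.
rewrite lactE (bigD1 h) //= ffunE eqxx scale1r big1 ?addr0 // => g /negPf gh.
by rewrite ffunE gh scale0r.
Qed.
Lemma ract_hA h x : ract x (hA h).1 = racth x h.
Proof.
rewrite ractE (bigD1 h) //= ffunE eqxx scale1r big1 ?addr0 // => g /negPf gh.
by rewrite ffunE gh scale0r.
Qed.

Lemma lactM a b x : lact (conv a b) x = lact a (lact b x).
Proof.
rewrite lactE; under eq_bigr do rewrite ffunE scaler_suml.
rewrite exchange_big [RHS]lactE; apply: eq_bigr => h _ /=.
rewrite (reindex_inj (mulgI h)) lactE lacth_sum scaler_sumr.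
apply: eq_bigr => g _; rewrite mulKg lacthZ scalerA; congr (_ *: _).
exact: td_lactM.
Qed.
Lemma ractM a b x : ract x (conv a b) = ract (ract x a) b.
Proof.
rewrite ractE; under eq_bigr do rewrite ffunE scaler_suml.
rewrite exchange_big [RHS]ractE.
under [RHS]eq_bigr do rewrite ractE racth_sum scaler_sumr.
rewrite [RHS]exchange_big; apply: eq_bigr => h _ /=.
rewrite (reindex_inj (mulgI h)).
apply: eq_bigr => g _; rewrite mulKg racthZ scalerA mulrC; congr (_ *: _).
exact: td_ractM.
Qed.
Lemma lract a b x : ract (lact a x) b = lact a (ract x b).
Proof.
rewrite ractE [RHS]lactE; under eq_bigr do rewrite lactE racth_sum scaler_sumr.
rewrite exchange_big; apply: eq_bigr => h _ /=.
rewrite ractE lacth_sum scaler_sumr; apply: eq_bigr => g _.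
rewrite lacthZ racthZ !scalerA mulrC; congr (_ *: _); exact: td_lract.
Qed.
Lemma lact_mul a x y : lact a (mulJ x y) = mulJ (lact a x) y.
Proof.
rewrite !lactE mulJ_suml; apply: eq_bigr => h _; rewrite mulJZl.
congr (_ *: _); exact: td_lact_mul.
Qed.
Lemma ract_mul a x y : ract (mulJ x y) a = mulJ x (ract y a).
Proof.
rewrite !ractE mulJ_sumr; apply: eq_bigr => h _; rewrite mulJZr.
congr (_ *: _); exact: td_ract_mul.
Qed.
Lemma mulJ_mid a x y : mulJ x (lact a y) = mulJ (ract x a) y.
Proof.
rewrite lactE ractE mulJ_sumr mulJ_suml; apply: eq_bigr => h _.
rewrite mulJZl mulJZr; congr (_ *: _); exact: td_mid.
Qed.

Lemma convA a b c : conv a (conv b c) = conv (conv a b) c.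
Proof.
apply/ffunP => g; rewrite !ffunE.
under [RHS]eq_bigr do rewrite ffunE mulr_suml.
rewrite [RHS]exchange_big; apply: eq_bigr => h _ /=.
rewrite ffunE mulr_sumr [RHS](reindex_inj (mulgI h)); apply: eq_bigr => u _ /=.
by rewrite mulKg invMg mulgA mulrA.
Qed.
Lemma convDl a b c : conv (a + b) c = conv a c + conv b c.
Proof.
apply/ffunP => g; rewrite !ffunE -big_split; apply: eq_bigr => h _.
by rewrite ffunE mulrDl.
Qed.
Lemma convDr a b c : conv a (b + c) = conv a b + conv a c.
Proof.
apply/ffunP => g; rewrite !ffunE -big_split; apply: eq_bigr => h _.
by rewrite ffunE mulrDr.
Qed.
Lemma convZl c a b : conv (c *: a) b = c *: conv a b.
Proof.
apply/ffunP => g; rewrite !ffunE scaler_sumr; apply: eq_bigr => h _.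
by rewrite ffunE scalerAl.
Qed.
Lemma convZr c a b : conv a (c *: b) = c *: conv a b.
Proof.
apply/ffunP => g; rewrite !ffunE scaler_sumr; apply: eq_bigr => h _.
by rewrite ffunE scalerAr.
Qed.
Lemma conv0 a : conv a 0 = 0.
Proof. by apply: (addrI (conv a 0)); rewrite -convDr !addr0. Qed.
Lemma conv0l a : conv 0 a = 0.
Proof. by apply: (addrI (conv 0 a)); rewrite -convDl !addr0. Qed.
Lemma conv_hA h a : conv (hA h).1 a = [ffun g => a (h^-1 * g)%g].
Proof.
apply/ffunP => g; rewrite !ffunE (bigD1 h) //= ffunE eqxx mul1r big1 ?addr0 //.
by move=> u /negPf uh; rewrite ffunE uh mul0r.
Qed.
Lemma conva_hA h a : conv a (hA h).1 = [ffun g => a (g * h^-1)%g].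
Proof.
apply/ffunP => g; rewrite !ffunE (bigD1 (g * h^-1)%g) //= ffunE.
rewrite invMg invgK mulgKV eqxx mulr1 big1 ?addr0 // => u ugh.
rewrite ffunE; case: eqP => [E|]; last by rewrite mulr0.
by case/eqP: ugh; rewrite -E invMg invgK mulgA mulgV mul1g.
Qed.
Lemma conv_hAhA h1 h2 : conv (hA h1).1 (hA h2).1 = (hA (h1 * h2)%g).1.
Proof.
rewrite conv_hA; apply/ffunP => g; rewrite !ffunE.
by rewrite -(inj_eq (mulgI h1)) mulKVg.
Qed.

Fact triA_mulA : associative triA_mul.
Proof.
move=> [a x] [b y] [c z]; congr pair => /=; first exact: convA.
rewrite lactM ractM !lactDr !ractDl !mulJDl !mulJDr lract lact_mul ract_mul.
rewrite mulJ_mid mulJA -!addrA; congr (_ + (_ + _)).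
rewrite addrCA; congr (_ + _).
by rewrite [RHS]addrCA; congr (_ + _); rewrite addrCA.
Qed.
Fact triA_mul1l : left_id triA_one triA_mul.
Proof.
move=> [a x]; rewrite /triA_mul conv_hA /= lact_hA ract0 mul0J !addr0.
congr pair; last exact: td_lact1.
by apply/ffunP => g; rewrite ffunE invg1 mul1g.
Qed.
Fact triA_mul1r : right_id triA_one triA_mul.
Proof.
move=> [a x]; rewrite /triA_mul conva_hA /= ract_hA lact0 mulJ0 addr0 add0r.
congr pair; last exact: td_ract1.
by apply/ffunP => g; rewrite ffunE invg1 mulg1.
Qed.
Fact triA_mulDl : left_distributive triA_mul +%R.
Proof.
move=> [a x] [b y] [c z]; congr pair => /=; first exact: convDl.
rewrite lactDl ractDl mulJDl -!addrA; congr (_ + _).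
rewrite addrCA; congr (_ + _).
by rewrite [RHS]addrCA; congr (_ + _); rewrite addrCA.
Qed.
Fact triA_mulDr : right_distributive triA_mul +%R.
Proof.
move=> [a x] [b y] [c z]; congr pair => /=; first exact: convDr.
rewrite lactDr ractDr mulJDr -!addrA; congr (_ + _).
rewrite addrCA; congr (_ + _).
by rewrite [RHS]addrCA; congr (_ + _); rewrite addrCA.
Qed.
Fact triA_oner_neq0 : triA_one != 0.
Proof.
apply/eqP => /(congr1 (fun u : triA => u.1 1%g)) /eqP.
by rewrite !ffunE eqxx oner_eq0.
Qed.
HB.instance Definition _ := GRing.Zmodule_isNzRing.Build triA
  triA_mulA triA_mul1l triA_mul1r triA_mulDl triA_mulDr triA_oner_neq0.

Fact triA_scalerAl (c : k) (u v : triA) : c *: (u * v) = (c *: u) * v.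
Proof.
case: u v => [a x] [b y]; congr pair => /=; first by rewrite convZl.
by rewrite lactZl ractZl mulJZl !scalerDr.
Qed.
Fact triA_scalerAr (c : k) (u v : triA) : c *: (u * v) = u * (c *: v).
Proof.
case: u v => [a x] [b y]; congr pair => /=; first by rewrite convZr.
by rewrite lactZr ractZr mulJZr !scalerDr.
Qed.
HB.instance Definition _ :=
  GRing.Lmodule_isLalgebra.Build k triA triA_scalerAl.
HB.instance Definition _ :=
  GRing.Lalgebra_isAlgebra.Build k triA triA_scalerAr.
HB.instance Definition _ := FinRing.isNzRing.Build triA.

End Algebra.

Record nontrivial_addchar (k : finFieldType) := NontrivialAddchar {
  addchar_fun :> k -> algC;
  addchar0 : addchar_fun 0 = 1;
  addcharD : {morph addchar_fun : s t / s + t >-> s * t};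
  addchar_neq1 : exists t, addchar_fun t != 1 }.

Definition disjoint_characters (gT : finGroupType) (G : {group gT})
    (phi psi : 'CF(G)) : Prop :=
  forall i : Iirr G, ~ (i \in irr_constt phi /\ i \in irr_constt psi).

(* \is a character holds of the zero class function, hence chi a != 0.
   Injectivity of K makes the indexed family, not only its range, a
   partition. *)
Definition supercharacter_theory (gT : finGroupType) (G : {group gT})
    (IA IB : finType) (chi : IA -> 'CF(G)) (K : IB -> {set gT}) : Prop :=
  [/\ (forall a, chi a \is a character /\ chi a != 0)
      /\ (forall a a', a != a' -> disjoint_characters (chi a) (chi a')),
      partition [set K b | b : IB] G /\ injective K,
      #|IA| = #|IB|,
      forall a b, {in K b &, forall g g', chi a g = chi a g'}
    & exists b, K b = [set 1%g]].

Arguments supercharacter_theory {gT} G {IA IB} chi K.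

Section Triangular.
Variables (k : finFieldType) (hT : finGroupType) (D : triangular_data k hT).
Local Notation A := (triA D).
Local Notation J := (triJ D).
Local Notation hA := (@hA k hT D).
Local Notation jA := (@jA k hT D).

Definition pJ (u : A) : J := u.2.

Lemma hAM h1 h2 : hA h1 * hA h2 = hA (h1 * h2)%g.
Proof.
rewrite /GRing.mul /= /triA_mul conv_hAhA /= lact0 ract0 mul0J !addr0.
by [].
Qed.
Lemma hA1 : hA 1%g = 1. Proof. by []. Qed.
Lemma hA_jA h x : hA h * jA x = jA (lacth h x).
Proof.
rewrite /GRing.mul /= /triA_mul /= lact_hA ract0 mul0J !addr0.
by rewrite conv0.
Qed.
Lemma jA_hA h x : jA x * hA h = jA (racth x h).
Proof.
rewrite /GRing.mul /= /triA_mul /= ract_hA lact0 mulJ0 addr0 add0r.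
by rewrite conv0l.
Qed.
Lemma jAM x y : jA x * jA y = jA (mulJ x y).
Proof.
rewrite /GRing.mul /= /triA_mul /= lact0l ract0r !add0r.
by rewrite conv0.
Qed.
Lemma jAD x y : jA (x + y) = jA x + jA y.
Proof. by congr pair; rewrite addr0. Qed.
Lemma hA_inj : injective hA.
Proof.
move=> h1 h2 /(congr1 (fun u : A => u.1 h1)) /eqP; rewrite !ffunE eqxx.
by case: (h1 =P h2) => // _; rewrite oner_eq0.
Qed.
Lemma jA_nil x : exists n, jA x ^+ n = 0.
Proof.
have [n nilJ] := td_nilpotent D; exists n.+1.
have -> m : jA x ^+ m.+1 = jA (foldl (@mulJ _ _ D) x (nseq m x)).
  elim: m => [|m IHm]; first by rewrite expr1.
  rewrite exprSr IHm jAM; congr jA.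
  have -> : nseq m.+1 x = rcons (nseq m x) x by elim: m {IHm} => //= m ->.
  by rewrite foldl_rcons.
by congr pair; apply: nilJ; rewrite size_nseq.
Qed.

Fact tunit_subproof h x : hA h + jA x \is a GRing.unit.
Proof.
have -> : hA h + jA x = hA h * (1 + jA (lacth h^-1%g x)).
  rewrite mulrDr mulr1 hA_jA; congr (_ + jA _).
  by have := td_lactM h h^-1%g x; rewrite mulgV td_lact1.
rewrite unitrMr.
  have [n xn0] := jA_nil (lacth h^-1%g x); move: (jA _) xn0 => u un0.
  apply/unitrP; exists (\sum_(i < n) (- u) ^+ i).
  have E : (1 + u) * (\sum_(i < n) (- u) ^+ i) = 1.
    apply: oppr_inj; rewrite -mulNr opprD addrC -subrX1 exprNn un0 mulr0.
    by rewrite sub0r.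
  split=> //; rewrite -[RHS]E; apply: commr_sym; apply: commr_sum => i _.
  apply: commrX; apply: commrN; apply: commr_sym.
  by apply: commrD => //; apply: commr1.
apply/unitrP; exists (hA h^-1%g).
by rewrite !hAM mulVg mulgV.
Qed.
Definition tunit h x : {unit A} := FinRing.unit A (tunit_subproof h x).

Lemma tunitM h1 x1 h2 x2 : (tunit h1 x1 * tunit h2 x2)%g
  = tunit (h1 * h2) (lacth h1 x2 + racth x1 h2 + mulJ x1 x2).
Proof.
apply: val_inj; rewrite /= mulrDl !mulrDr hAM hA_jA jA_hA jAM !jAD.
by rewrite !addrA.
Qed.
Lemma tunit1 : tunit 1 0 = 1%g.
Proof. by apply: val_inj; rewrite /= addr0. Qed.

Definition triG : {set {unit A}} := [set tunit h x | h : hT, x : J].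

Fact triG_group_set : group_set triG.
Proof.
apply/group_setP; split; first by rewrite -tunit1; apply: imset2_f.
move=> _ _ /imset2P[h1 x1 _ _ ->] /imset2P[h2 x2 _ _ ->].
by rewrite tunitM; apply: imset2_f.
Qed.
Canonical triG_group := Group triG_group_set.

Definition idem : {set A} := [set e | e * e == e].
Definition idemH : {set A} := [set e in idem | pJ e == 0].

Definition Acorner (e : A) : {set A} := [set e * a * e | a : A].
Definition Jcorner (e : A) : {set J} := [set pJ (e * jA x * e) | x : J].

Definition Hcorner (e : A) : {set A} := [set hA h * e | h : hT].
Definition Ncorner (e : A) : {set A} := [set e + jA x | x in Jcorner e].
Definition Gcorner (e : A) : {set A} :=
  [set u + jA x | u in Hcorner e, x in Jcorner e].

(* The inverse of u in the group Gcorner e, whose identity is e. *)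
Definition cinv (e u : A) : A :=
  odflt 0 [pick v in Gcorner e | (u * v == e) && (v * u == e)].

(* The triples (t, a, b) are encoded as ((t, a), b); for e = 1 this is the
   group acting on J and on G. *)
Definition Gtilde (e : A) : {set A * A * A} :=
  setX (setX (Hcorner e) (Ncorner e)) (Ncorner e).
Definition tmul (e : A) (s1 s2 : A * A * A) : A * A * A :=
  let: (t1, a1, b1) := s1 in let: (t2, a2, b2) := s2 in
  (t1 * t2, cinv e t2 * a1 * t2 * a2, cinv e t2 * b1 * t2 * b2).
Definition tinv (e : A) (s : A * A * A) : A * A * A :=
  odflt s [pick r in Gtilde e | tmul e r s == (e, e, e)].

Definition rho (e : A) (s : A * A * A) (x : J) : J :=
  let: (t, a, b) := s in pJ (t * a * jA x * cinv e b * cinv e t).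
Definition orbJ (e : A) (x : J) : {set J} := [set rho e s x | s in Gtilde e].

Definition regularJ (e : A) (x : J) : bool :=
  (x \in Jcorner e) &&
  [forall f in Acorner e, (f \in idem) && (f != e) ==> (x \notin Jcorner f)].
Definition regular_orbJ (e : A) (w : {set J}) : bool :=
  [exists x in Jcorner e, w == orbJ e x] && [forall x in w, regularJ e x].

Definition triJdual := finvect_type 'Hom(J, k^o).
HB.instance Definition _ := Vector.on triJdual.
HB.instance Definition _ := Finite.on triJdual.

Definition Jdual (e : A) : {set triJdual} :=
  [set l : triJdual | [forall x : J,
    [&& l (pJ (e * jA x * (1 - e))) == 0, l (pJ ((1 - e) * jA x * e)) == 0
      & l (pJ ((1 - e) * jA x * (1 - e))) == 0]]].

Lemma rho_linear e s c x y :
  rho e s (c *: x + y) = c *: rho e s x + rho e s y.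
Proof.
case: s => [[t a] b]; rewrite /rho; move: (t * a) => u.
have -> : jA (c *: x + y) = c *: jA x + jA y.
  by congr pair; rewrite /= ?scaler0 ?addr0.
rewrite mulrDr !mulrDl -scalerAr -!scalerAl.
by [].
Qed.

(* For l in Jdual e the form x |-> l (rho e _ x) on all of J is again the
   extension by zero of its restriction to Jcorner e. *)
Definition rho_dual (e : A) (s : A * A * A) (l : triJdual) : triJdual :=
  linfun (fun x : J => l (rho e (tinv e s) x)).
Lemma rho_dualE e s l x : rho_dual e s l x = l (rho e (tinv e s) x).
Proof.
pose f (y : J) : k^o := l (rho e (tinv e s) y).
have fP : linear f by move=> c y z; rewrite /f rho_linear linearP.
pose m := GRing.isLinear.Build k J k^o *:%R f fP.
pose g : {linear J -> k^o} := HB.pack f m.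
exact: (lfunE g).
Qed.
Definition orbJdual (e : A) (l : triJdual) : {set triJdual} :=
  [set rho_dual e s l | s in Gtilde e].

Definition regularJdual (e : A) (l : triJdual) : bool :=
  (l \in Jdual e) &&
  [forall f in Acorner e, (f \in idem) && (f != e) ==> (l \notin Jdual f)].
Definition regular_orbJdual (e : A) (w : {set triJdual}) : bool :=
  [exists l in Jdual e, w == orbJdual e l]
  && [forall l in w, regularJdual e l].

Definition Hfix (e : A) : {set hT} := [set h | hA h * e == e].

Fact Hfix_group_set e : group_set (Hfix e).
Proof.
apply/group_setP; split=> [|h1 h2]; first by rewrite inE hA1 mul1r.
by rewrite !inE => /eqP E1 /eqP E2; rewrite -hAM -mulrA E2 E1.
Qed.
Canonical Hfix_group e := Group (Hfix_group_set e).

Definition Ract (s : A * A * A) (g : A) : A :=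
  let: (t, a, b) := s in 1 + t * a * (g - 1) * cinv 1 b * cinv 1 t.
Definition superclass (g : {unit A}) : {set {unit A}} :=
  [set u : {unit A} | [exists s in Gtilde 1, val u == Ract s (val g)]].

Definition indexB_pred (b : A * hT * {set J}) : bool :=
  let: (e, h, w) := b in
  [&& e \in idemH, h \in Hfix e & regular_orbJ e w].
Definition indexB := {b : A * hT * {set J} | indexB_pred b}.

Fact Gtilde_inh e : (hA 1 * e, e + jA 0, e + jA 0) \in Gtilde e.
Proof.
have J0 : 0 \in Jcorner e.
  by apply/imsetP; exists 0 => //; rewrite mulr0 mul0r.
rewrite !in_setX /=; apply/andP; split; last by apply/imsetP; exists 0.
by apply/andP; split; apply/imsetP; [exists 1%g | exists 0].
Qed.
Fact indexB_inh (b : indexB) : exists y, y \in (val b).2.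
Proof.
case: b => [[[e h] w] /= /and3P[_ _ /andP[/exists_inP[x _ /eqP->] _]]].
exists (rho e (hA 1 * e, e + jA 0, e + jA 0) x); apply: imset_f.
exact: Gtilde_inh.
Qed.

(* y = xchoose _ is a representative of the orbit. *)
Definition Kclass (b : indexB) : {set {unit A}} :=
  superclass (tunit (val b).1.2 (xchoose (indexB_inh b))).

Definition Jright (l : triJdual) : {set J} :=
  [set x | [forall y : J, l (mulJ x y) == 0]].

(* A form in J_e^* together with its idempotent e in kH. *)
Record dual_point := DualPoint {
  dp_idem : A;
  dp_form : triJdual;
  dp_idemP : dp_idem \in idemH;
  dp_formP : dp_form \in Jdual dp_idem }.

Definition Glam (p : dual_point) : {set {unit A}} :=
  [set tunit h x | h in Hfix (dp_idem p), x in Jright (dp_form p)].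

Lemma formD (l : triJdual) x y : l (x + y) = l x + l y.
Proof. exact: linearD. Qed.
Lemma idemHC e h : e \in idemH -> e * hA h = hA h * e.
Proof.
case: e => a x; rewrite !inE /= /pJ => /andP[_ /eqP/= ->].
rewrite /GRing.mul /= /triA_mul /= !lact0 !ract0 !mul0J; congr pair.
rewrite [LHS](conva_hA D h) [RHS](conv_hA D h).
apply/ffunP => g; rewrite !ffunE; congr (a _).
by have /centsP := td_abelian D; apply; rewrite inE.
Qed.
Lemma pJD u v : pJ (u + v) = pJ u + pJ v. Proof. by []. Qed.
Lemma Jdual_corner e l x : l \in Jdual e -> l x = l (pJ (e * jA x * e)).
Proof.
rewrite inE => /forallP/(_ x)/and3P[/eqP l1 /eqP l2 /eqP l3].
have xE : x = pJ (e * jA x * e) + pJ (e * jA x * (1 - e))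
     + (pJ ((1 - e) * jA x * e) + pJ ((1 - e) * jA x * (1 - e))).
  have eE : e + (1 - e) = 1 by rewrite addrC subrK.
  by rewrite -!pJD -!mulrDr eE !mulr1 -mulrDl eE mul1r.
have lD a b c d : l (a + b + (c + d)) = l a + l b + (l c + l d).
  by rewrite !formD.
by rewrite {1}xE lD l1 l2 l3 !addr0.
Qed.

Lemma dual_lacth e l h x : e \in idemH -> l \in Jdual e -> h \in Hfix e ->
  l (lacth h x) = l x.
Proof.
move=> He le; rewrite inE => /eqP he; rewrite (Jdual_corner _ le) -hA_jA mulrA.
by rewrite idemHC // he -(Jdual_corner _ le).
Qed.
Lemma dual_racth e l h x : e \in idemH -> l \in Jdual e -> h \in Hfix e ->
  l (racth x h) = l x.
Proof.
move=> He le; rewrite inE => /eqP he; rewrite (Jdual_corner _ le) -jA_hA.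
by rewrite mulrA -mulrA he -(Jdual_corner _ le).
Qed.
Lemma Jright_mul (l : triJdual) x y : x \in Jright l -> l (mulJ x y) = 0.
Proof. by rewrite inE => /forallP/(_ y)/eqP. Qed.

Fact Glam_group_set p : group_set (Glam p).
Proof.
case: p => e l He le; rewrite /Glam /=; apply/group_setP; split.
  rewrite -tunit1; apply: imset2_f; first exact: group1.
  by rewrite inE; apply/forallP => y; rewrite mul0J linear0.
move=> _ _ /imset2P[h1 x1 Hh1 Jx1 ->] /imset2P[h2 x2 Hh2 Jx2 ->].
rewrite tunitM; apply: imset2_f; first exact: groupM.
rewrite inE; apply/forallP => y; rewrite !mulJDl !formD.
rewrite -mulJA (Jright_mul _ Jx1) -[mulJ (racth _ _) _]mulJ_midh.
rewrite (Jright_mul _ Jx1) -lacth_mul (dual_lacth _ He le) //.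
by rewrite (Jright_mul _ Jx2) !addr0.
Qed.
Canonical Glam_group p := Group (Glam_group_set p).

(* The component h of u = h + x in G; its component x is pJ (val u). *)
Definition hpart (u : {unit A}) : hT :=
  odflt 1%g [pick h | (hA h).1 == (val u).1].

Lemma hpart_tunit h x : hpart (tunit h x) = h.
Proof.
rewrite /hpart; case: pickP => [g /eqP /= E|/(_ h)/eqP[]]; last first.
  by rewrite /= addr0.
by apply: hA_inj; congr pair; rewrite -[RHS]addr0.
Qed.
Lemma pJ_tunit h x : pJ (val (tunit h x)) = x.
Proof. by rewrite /pJ /= add0r. Qed.

Definition xi_fun (eps : nontrivial_addchar k) (p : dual_point)
    (theta : 'CF(Hfix (dp_idem p))) (u : {unit A}) : algC :=
  if u \in Glam p then theta (hpart u) * eps (dp_form p (pJ (val u))) else 0.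

Fact xi_subproof eps p theta :
  is_class_fun <<Glam p>> (finfun (@xi_fun eps p theta)).
Proof.
rewrite genGid; apply: intro_class_fun; last by move=> u /negPf Gu;
  rewrite /xi_fun Gu.
move=> u v Gu Gv; rewrite /xi_fun (groupJr _ Gv) Gu; move: Gu Gv.
case: p theta => e l He le theta.
rewrite /Glam [dp_form _]/= [dp_idem _]/=.
have key h1 x1 h2 x2 : h1 \in Hfix e -> x1 \in Jright l -> h2 \in Hfix e ->
    x2 \in Jright l -> l (lacth h1 x2 + racth x1 h2 + mulJ x1 x2) = l x1 + l x2.
  move=> Hh1 Jx1 Hh2 Jx2; rewrite !formD (dual_lacth _ He le) //.
  by rewrite (dual_racth _ He le) // (Jright_mul _ Jx1) addr0 addrC.
have abel : commutative (@mulg hT).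
  by move=> g h; have /centsP := td_abelian D; apply; rewrite inE.
move=> /imset2P[h1 x1 Hh1 Jx1 ->] /imset2P[h2 x2 Hh2 Jx2 ->].
have : (tunit h1 x1 ^ tunit h2 x2)%g \in Glam (DualPoint He le).
  by apply: groupJ; apply: imset2_f.
case/imset2P => h3 x3; rewrite [dp_form _]/= [dp_idem _]/= => Hh3 Jx3 E3; rewrite E3 !hpart_tunit !pJ_tunit.
have : (tunit h2 x2 * tunit h3 x3 = tunit h1 x1 * tunit h2 x2)%g.
  by rewrite -E3 -conjgC.
rewrite !tunitM => E.
have h31 : h3 = h1.
  by have := congr1 hpart E; rewrite !hpart_tunit abel => /mulIg.
have := congr1 (fun w => l (pJ (val w))) E.
rewrite !pJ_tunit !key // [RHS]addrC => /addrI ->.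
by rewrite h31.
Qed.
(* The class function h + x |-> theta h * eps (lambda x) on G_lambda. *)
Definition xi eps p theta : 'CF(Glam p) := Cfun 0 (@xi_subproof eps p theta).

Lemma xiE eps p theta h x : h \in Hfix (dp_idem p) ->
  x \in Jright (dp_form p) ->
  @xi eps p theta (tunit h x) = theta h * eps (dp_form p x).
Proof.
by move=> Hh Jx; rewrite cfunE /xi_fun imset2_f // hpart_tunit pJ_tunit.
Qed.

Definition chi_point eps p theta : 'CF(triG) := 'Ind[triG] (@xi eps p theta).

Definition indexA_pred
    (a : {e : A & (Iirr (Hfix e) * {set triJdual})%type}) : bool :=
  [&& tag a \in idemH, 'chi_(tagged a).1 \is a linear_char
    & regular_orbJdual (tag a) (tagged a).2].
Definition indexA :=
  {a : {e : A & (Iirr (Hfix e) * {set triJdual})%type} | indexA_pred a}.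

Fact indexA_inh (a : indexA) : exists l, l \in (tagged (val a)).2.
Proof.
case: a => [[e [i w]] /= /and3P[_ _ /andP[/exists_inP[l _ /eqP/= ->] _]]].
exists (rho_dual e (hA 1 * e, e + jA 0, e + jA 0) l); apply: imset_f.
exact: Gtilde_inh.
Qed.
Fact indexA_idem (a : indexA) : tag (val a) \in idemH.
Proof. by case/and3P: (valP a). Qed.
Fact indexA_form (a : indexA) : xchoose (indexA_inh a) \in Jdual (tag (val a)).
Proof.
case/and3P: (valP a) => _ _ /andP[_ /forall_inP regA].
by have /regA/andP[] := xchooseP (indexA_inh a).
Qed.

Definition chi_index (eps : nontrivial_addchar k) (a : indexA) : 'CF(triG) :=
  @chi_point eps (DualPoint (indexA_idem a) (indexA_form a))
    'chi_(tagged (val a)).1.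

End Triangular.

(* The default values in cinv and tinv are never used: on the relevant
   arguments both are genuine inverses. *)
Section Inverses.
Variables (k : finFieldType) (hT : finGroupType) (D : triangular_data k hT).
Local Notation A := (triA D).
Local Notation hA := (@hA k hT D).
Local Notation jA := (@jA k hT D).
Variable e : A.
Hypothesis He : e \in idemH D.

Lemma ee : e * e = e. Proof. by move: He; rewrite !inE => /andP[/eqP]. Qed.
Lemma jA_pJ (u : A) : u.1 = 0 -> jA (pJ u) = u. Proof. by case: u => a x /= ->. Qed.
Lemma mul1E (u v : A) : (u * v).1 = conv u.1 v.1. Proof. by []. Qed.
Lemma corner1 x (u v : A) : (u * jA x * v).1 = 0.
Proof. by rewrite !mul1E /= conv0 conv0l. Qed.
Lemma JcP x : x \in Jcorner e -> jA x = e * jA x * e.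
Proof.
case/imsetP => y _ ->; rewrite jA_pJ ?corner1 //.
by rewrite !mulrA ee -!mulrA ee.
Qed.
Lemma JcI x : e * jA x * e = jA x -> x \in Jcorner e.
Proof. by move=> E; apply/imsetP; exists x => //; rewrite E. Qed.
Lemma eJ x : x \in Jcorner e -> e * jA x = jA x.
Proof. by move=> /JcP ->; rewrite !mulrA ee. Qed.
Lemma Je x : x \in Jcorner e -> jA x * e = jA x.
Proof. by move=> /JcP ->; rewrite -!mulrA ee. Qed.
Lemma Gc_e u : u \in Gcorner e -> e * u = u /\ u * e = u.
Proof.
case/imset2P => _ x /imsetP[h _ ->] Jx ->.
by rewrite mulrDl mulrDr eJ // Je // mulrA idemHC // -!mulrA ee.
Qed.

Lemma cinvP u : u \in Gcorner e ->
  [/\ cinv e u \in Gcorner e, u * cinv e u = e & cinv e u * u = e].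
Proof.
move=> Gu; rewrite /cinv; case: pickP => [v /and3P[Gv /eqP -> /eqP ->]//|no].
case/imset2P: Gu no => _ x /imsetP[h _ ->] Jx ->.
have guC (h' : hT) (y : triJ D) : e * (hA h' + jA y) * e = hA h' * e + e * jA y * e.
  by rewrite mulrDr mulrDl idemHC // -mulrA ee.
have: (tunit h x)^-1%g \in triG D by rewrite groupV imset2_f.
case/imset2P => h' x' _ _ E.
have E1 : (hA h + jA x) * (hA h' + jA x') = 1.
  by have := congr1 val (mulgV (tunit h x)); rewrite E.
have E2 : (hA h' + jA x') * (hA h + jA x) = 1.
  by have := congr1 val (mulVg (tunit h x)); rewrite E.
have C : e * (hA h + jA x) = (hA h + jA x) * e.
  by rewrite mulrDr mulrDl idemHC // eJ // Je.
have Gv : e * (hA h' + jA x') * e \in Gcorner e.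
  rewrite guC -[e * jA x' * e]jA_pJ ?corner1 //.
  by apply: imset2_f; apply: imset_f.

move/(_ (e * (hA h' + jA x') * e)); rewrite Gv /=.
have -> : hA h * e + jA x = e * (hA h + jA x) * e by rewrite guC -JcP.
move: (hA h + jA x) (hA h' + jA x') E1 E2 C {E} => U W E1 E2 C.
have CW : e * W = W * e.
  by rewrite -[LHS]mul1r -E2 -[W * U * _]mulrA [U * (e * W)]mulrA -C -[e * U * W]mulrA E1 mulr1.
have P X Y : X * Y = 1 -> e * X = X * e -> e * Y = Y * e ->
    e * X * e * (e * Y * e) = e.
  move=> XY CX CY; rewrite CX CY -[X * e * e]mulrA ee -[Y * e * e]mulrA ee.
  by rewrite mulrA -[X * e * Y]mulrA CY mulrA XY mul1r ee.
by rewrite !P // eqxx.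
Qed.
Lemma cinv_uniq u v : u \in Gcorner e -> v \in Gcorner e -> u * v = e ->
  cinv e u = v.
Proof.
move=> Gu Gv uv; have [Gw uw wu] := cinvP Gu.
have /esym := congr1 (fun z => cinv e u * z) uv.
by rewrite mulrA wu (proj1 (Gc_e Gv)) (proj2 (Gc_e Gw)).
Qed.

Lemma hAe_in h : hA h * e \in Gcorner e.
Proof.
have -> : hA h * e = hA h * e + jA 0 by exact: (esym (addr0 _)).
apply: imset2_f; first exact: imset_f.
by apply: JcI; rewrite mulr0 mul0r.
Qed.
Lemma Nc_Gc a : a \in Ncorner e -> a \in Gcorner e.
Proof.
case/imsetP => x Jx ->; apply: imset2_f => //.
by apply/imsetP; exists 1%g => //; rewrite hA1 mul1r.
Qed.
Lemma cinv_H h : cinv e (hA h * e) = hA h^-1%g * e.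
Proof.
apply: cinv_uniq; try exact: hAe_in.
by rewrite -mulrA [e * _]mulrA idemHC // -[_ * e * e]mulrA ee mulrA hAM mulgV hA1 mul1r.
Qed.
Lemma cinv_N a : a \in Ncorner e -> cinv e a \in Ncorner e.
Proof.
move=> Na; have [Gv av _] := cinvP (Nc_Gc Na).
move: (cinv e a) Gv av => v Gv; case/imsetP: Na => x Jx ->.
case/imset2P: Gv => _ y /imsetP[h _ ->] Jy ->.
rewrite mulrDl !mulrDr eJ // => E.
apply/imsetP; exists y => //; congr (_ + _).
have e2 : e.2 = 0 by move: He; rewrite !inE /pJ => /andP[_ /eqP].
have F1 (u1 u2 : A) : (u1 + u2).1 = u1.1 + u2.1 by [].
rewrite [LHS]surjective_pairing [RHS]surjective_pairing; congr pair; last first.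
  by rewrite /= e2 lact0 ract0 mulJ0 !addr0.
have := congr1 fst E; rewrite !F1 !mul1E /= !conv0 !conv0l !addr0 => E4; rewrite -[RHS]E4.
have : hA h * e = e * (hA h * e) by rewrite mulrA idemHC // -mulrA ee.
by move/(congr1 fst) => E5; exact: E5.
Qed.
Lemma tinvP s : s \in Gtilde e ->
  tinv e s \in Gtilde e /\ tmul e (tinv e s) s = (e, e, e).
Proof.
move=> Gs; rewrite /tinv; case: pickP => [r /andP[Gr /eqP]//|].
case: s Gs => [[t a] b]; rewrite !in_setX /= => /andP[/andP[/imsetP[h _ ->] Na] Nb].
have H2 h1 : hA h1 * e * (hA h1^-1%g * e) = e.
  by rewrite -mulrA [e * _]mulrA idemHC // -[_ * e * e]mulrA ee mulrA hAM mulgV hA1 mul1r.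
have H3 h1 : hA h1^-1%g * e * (hA h1 * e) = e.
  by have := H2 h1^-1%g; rewrite invgK.
have cN c : c \in Ncorner e -> hA h * e * c * (hA h^-1%g * e) \in Ncorner e.
  case/imsetP => x Jx ->; rewrite mulrDr mulrDl -[_ * e * e]mulrA ee H2.
  rewrite -[_ * jA x * _]jA_pJ ?corner1 //; apply: imset_f; apply: JcI.
  rewrite jA_pJ ?corner1 //; have [et _] := Gc_e (hAe_in h).
  have [_] := Gc_e (hAe_in h^-1%g); move: (hA h * e) (hA h^-1%g * e) et => u u' et te.
  by rewrite !mulrA et -[_ * u' * e]mulrA te.
move/(_ (hA h^-1%g * e, hA h * e * cinv e a * (hA h^-1%g * e),
                        hA h * e * cinv e b * (hA h^-1%g * e))).
have HH : hA h^-1%g * e \in Hcorner e by exact: imset_f.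
rewrite !in_setX /= HH !cN ?cinv_N //= cinv_H H3.
have Q c : c \in Ncorner e -> hA h^-1%g * e * (hA h * e * cinv e c * (hA h^-1%g * e)) *
   (hA h * e) * c = e.
  move=> Nc; have [Gc _ cc] := cinvP (Nc_Gc Nc).
  have [et _] := Gc_e (hAe_in h); have [_] := Gc_e (hAe_in h^-1%g).
  have := H3 h; move: (hA h * e) (hA h^-1%g * e) et => u u' et tt te.
  have [ec ce] := Gc_e Gc.
  by rewrite !mulrA tt ec -[_ * u' * u]mulrA tt ce cc.
by rewrite !Q // eqxx.
Qed.

End Inverses.

(* Main.v *)
(* Both J and its dual J* are A-bimodules, and the Gtilde-orbits are those of
   the group of pairs (u, v) = (ta, tb), acting by m |-> u m v^-1; likewise
   superclasses are the orbits of g - 1 in the bimodule A.  For a bimodule M,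
   every element of M_e has in its orbit a regular element of M_f for some
   idempotent f <= e of kH, because an idempotent of A is conjugate under 1 + J
   to its projection to kH.  The idempotent f is unique: if z in f A f annihilates
   a regular element of M_f on both sides then z lies in J, as kH is reduced.
   Hence the number of orbits in M_e is the sum over f <= e of the number of
   regular orbits in M_f; by Burnside's formula and duality J_e and J_e* have
   equally many orbits, so they have equally many regular ones.

   An element h - 1 + x is brought by a Schur complement to h - 1 + y with y in
   J_p, where p is the largest idempotent of kH with h p = p, and then y is moved
   to a regular element; this yields the partition into superclasses.

   If two supercharacters are not orthogonal, Mackey's formula gives s such that
   xi g = xi' (g^s) whenever both sides are defined.  On 1 + J this says that
   l - s l' s^-1 vanishes on the annihilator of J l + J (s l' s^-1), hence lies in
   that space, so l and l' are in one orbit; evaluation on H(e) then identifies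
   the linear characters. *)

Require Import Defs.
From HB Require Import structures.
From mathcomp Require Import all_boot all_order all_algebra.
From mathcomp Require Import all_fingroup all_solvable all_field all_character.

Set Implicit Arguments.
Unset Strict Implicit.
Unset Printing Implicit Defensive.

Import GroupScope GRing.Theory.
Local Open Scope ring_scope.

(** * The group algebra part of A *)

(** By pigeonhole [z ^+ i = z ^+ j] with [i < j], so the powers of [z] have period [j - i] from [i]
    on; the exponent chosen is a positive multiple of this period that is at least [i]. *)
Lemma idem_exp (R : finNzRingType) (z : R) :
  exists2 n, (0 < n)%N & z ^+ n * z ^+ n = z ^+ n.
Proof.
pose f (i : 'I_#|R|.+1) := z ^+ i.
have /injectivePn[i [j ij fij]] : ~~ injectiveb f.
  apply/negP => /injectiveP/leq_card.
  by rewrite card_ord ltnn.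
wlog lt_ij : i j ij fij / (i < j)%N.
  move=> W; case: (ltngtP i j) => [|| /val_inj E]; first exact: W.
  - by apply: W; rewrite 1?eq_sym.
  - by rewrite E eqxx in ij.
have per1 m : (i <= m)%N -> z ^+ (m + (j - i)) = z ^+ m.
  move=> im; rewrite -{1}(subnK im) -addnA subnKC; last exact: ltnW.
  by rewrite exprD -[z ^+ j]fij -exprD subnK.
have per m l : (i <= m)%N -> z ^+ (m + l * (j - i)) = z ^+ m.
  move=> im; elim: l => [|l IHl]; first by rewrite addn0.
  by rewrite mulSnr addnA per1 // (leq_trans im) ?leq_addr.
exists (i.+1 * (j - i))%N; first by rewrite muln_gt0 subn_gt0.
rewrite -exprD per //; apply: leq_trans (leqnSn _) _.
by rewrite leq_pmulr // subn_gt0.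
Qed.

Section GroupAlgebraPart.
Variables (k : finFieldType) (hT : finGroupType) (D : triangular_data k hT).
Local Notation A := (triA D).
Local Notation hA := (@hA k hT D).
Local Notation jA := (@jA k hT D).
Implicit Types u v e : A.

(** A ring morphism with kernel [J], viewed as an endomorphism of [A]; its image is the commutative
    ring kH. *)
Definition kHproj u : A := (u.1, 0).
Local Notation pr := kHproj.

Lemma kHprojD u v : pr (u + v) = pr u + pr v.
Proof. by congr pair; rewrite addr0. Qed.
Lemma kHprojM u v : pr (u * v) = pr u * pr v.
Proof. by congr pair; rewrite /= lact0 ract0 mul0J !addr0. Qed.
Lemma kHproj1 : pr 1 = 1. Proof. by []. Qed.
Lemma kHprojN u : pr (- u) = - pr u.
Proof. by congr pair; rewrite oppr0. Qed.
Lemma kHprojB u v : pr (u - v) = pr u - pr v.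
Proof. by rewrite kHprojD kHprojN. Qed.
Lemma kHprojX u n : pr (u ^+ n) = pr u ^+ n.
Proof. by elim: n => // n IHn; rewrite !exprS kHprojM IHn. Qed.
Lemma kHproj_id u : pr (pr u) = pr u. Proof. by []. Qed.
Lemma kHproj_hA h : pr (hA h) = hA h. Proof. by []. Qed.
Lemma kHproj_jA x : pr (jA x) = 0. Proof. by []. Qed.

Lemma kHproj_split u : u = pr u + jA (pJ u).
Proof. by case: u => a x; congr pair; rewrite /= ?addr0 ?add0r. Qed.

Lemma kHproj0P u : pr u = 0 -> u = jA (pJ u).
Proof. by move=> u0; rewrite {1}(kHproj_split u) u0 add0r. Qed.

Lemma kHproj0_nil u : pr u = 0 -> exists n, u ^+ n = 0.
Proof. by move=> /kHproj0P->; apply: jA_nil. Qed.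

Lemma hA_comm g h : hA g * hA h = hA h * hA g.
Proof.
rewrite !hAM; congr hA; have /centsP := td_abelian D.
by apply; rewrite inE.
Qed.

Lemma hAX h n : hA h ^+ n = hA (h ^+ n)%g.
Proof. by elim: n => [|n IHn]; rewrite ?expr0 // exprS IHn hAM expgS. Qed.

Lemma kHproj_sum u : pr u = \sum_h u.1 h *: hA h.
Proof.
rewrite [RHS]surjective_pairing /kHproj; congr pair; last first.
  by rewrite (raddf_sum (snd : A -> _)) big1 // => h _; rewrite /= scaler0.
rewrite (raddf_sum (fst : A -> _)); apply/ffunP => g.
rewrite sum_ffunE (bigD1 g) //= !ffunE eqxx big1 ?addr0; last first.
  by move=> h /negPf gh; rewrite !ffunE eq_sym gh scaler0.
by rewrite [_ *: _]mulr1.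
Qed.

Lemma kHprojC u v : pr u * pr v = pr v * pr u.
Proof.
rewrite !kHproj_sum mulr_suml [RHS]mulr_sumr; apply: eq_bigr => h _.
rewrite mulr_suml mulr_sumr; apply: eq_bigr => g _.
by rewrite -!scalerAl -!scalerAr hA_comm !scalerA mulrC.
Qed.

(** Take [Q = #|k| ^ totient #|hT|]. It is a power of the characteristic, so the [Q]-th power is
    additive on commuting elements; it fixes the scalars; and since the characteristic is prime to
    the order of H, Euler's theorem makes it fix each [h]. *)
Lemma kHproj_pow : exists2 Q, (1 < Q)%N & forall u, pr u ^+ Q = pr u.
Proof.
have [p p_pr charp] := finPcharP k.
have charA : p \in [pchar A] by rewrite pchar_lalg.
have frob m u v : GRing.comm u v ->
    (u + v) ^+ (p ^ m) = u ^+ (p ^ m) + v ^+ (p ^ m).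
  elim: m u v => [|m IHm] u v uv; first by rewrite !expr1.
  rewrite expnS !exprM -IHm; last by apply: commrX; apply/commr_sym/commrX.
  by congr (_ ^+ _); have := pFrobenius_autD_comm charA uv.
have [m _ qm] : exists2 m, (0 < m)%N & #|k| = (p ^ m)%N.
  have := card_pprimeChar charp; set m := logn p _ => qm.
  by exists m => //; case: m qm (finNzRing_gt1 k) => // ->.
have cop : coprime #|k| #|hT|.
  rewrite qm coprime_pexpl ?prime_coprime //; last first.
    by case: m qm (finNzRing_gt1 k) => // ->.
  exact: td_char D p charp.
have [q1 q0] : (1 < #|k|)%N /\ (0 < totient #|hT|)%N.
  by rewrite finNzRing_gt1 totient_gt0; split=> //; apply/card_gt0P; exists 1%g.
pose Q := (#|k| ^ totient #|hT|)%N.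
have ckQ (c : k) l : c ^+ (#|k| ^ l) = c.
  by elim: l => [|l IHl]; rewrite ?expr1 // expnS exprM expf_card.
have Q1 : (1 < Q)%N by rewrite -(exp1n (totient #|hT|)) ltn_exp2r.
exists Q => //.
move=> u; rewrite kHproj_sum.
have -> : Q = (p ^ (m * totient #|hT|))%N by rewrite expnM -qm.
have QE : (p ^ (m * totient #|hT|))%N = Q by rewrite expnM -qm.
move: (frob (m * totient #|hT|)%N); rewrite QE => frobQ.
pose t h : A := u.1 h *: hA h.
rewrite -[RHS](_ : \sum_h t h ^+ Q = _); last first.
  apply: eq_bigr => h _; rewrite /t exprZn ckQ; congr (_ *: _).
  rewrite hAX; congr hA.
  have hd : (#[h] %| #|hT|)%N by rewrite -cardsT order_dvdG ?inE.
  apply/eqP; rewrite -[X in _ == X]expg1 eq_expg_mod_order -(modn_dvdm Q hd).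
  by rewrite (Euler_exp_totient cop) modn_dvdm.
(* The commutation clause is carried through the induction because Frobenius additivity requires the
   partial sum to commute with the next term. *)
pose K (x y : A) := x ^+ Q = y /\ forall v, x * pr v = pr v * x.
suff /(_ (index_enum hT)) : forall r : seq hT,
  K (\sum_(h <- r) t h) (\sum_(h <- r) t h ^+ Q) by case.
elim=> [|h r [IH1 IH2]].
  rewrite !big_nil; split=> [|v]; last by rewrite mulr0 mul0r.
  by rewrite expr0n; case: (Q) Q1.
rewrite !big_cons; split; last first.
  move=> v; rewrite mulrDl mulrDr IH2; congr (_ + _).
  by rewrite /t -scalerAl -scalerAr; congr (_ *: _); apply: (kHprojC (hA h)).
rewrite frobQ ?IH1 //.
by rewrite /GRing.comm /t -scalerAl -scalerAr; congr (_ *: _);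
  have := IH2 (hA h).
Qed.

(** Iterating the previous identity, [pr u] equals its power of exponent [Q ^ n], which is at least
    [n]. *)
Lemma kHproj_reduced u n : pr u ^+ n = 0 -> pr u = 0.
Proof.
have [Q Q1 HQ] := kHproj_pow => un0.
have E m : pr u ^+ (Q ^ m) = pr u.
  by elim: m => [|m IHm]; rewrite ?expr1 // expnS exprM HQ.
have nQ : (n <= Q ^ n)%N by apply/ltnW/ltn_expl.
by rewrite -(E n) -(subnK nQ) exprD un0 mulr0.
Qed.

Lemma idemHP e : reflect (e * e = e /\ pr e = e) (e \in idemH D).
Proof.
rewrite !inE; apply: (iffP andP) => [[/eqP ee /eqP e2]|[ee prE]]; last first.
  by rewrite ee -prE !eqxx.
by split=> //; case: e ee e2 => a x _; rewrite /pJ /= => ->.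
Qed.

Lemma idemH_proj f : f * f = f -> pr f \in idemH D.
Proof. by move=> ff; apply/idemHP; rewrite -kHprojM ff. Qed.

Lemma idemHK e f : e \in idemH D -> f \in idemH D -> e * f = f * e.
Proof. by move=> /idemHP[_ <-] /idemHP[_ <-]; apply: kHprojC. Qed.

Lemma idemH_comm e u : e \in idemH D -> e * pr u = pr u * e.
Proof. by move=> /idemHP[_ <-]; apply: kHprojC. Qed.

End GroupAlgebraPart.

(** * Bimodules and the group of pairs (ta, tb) *)

Section Twin.
Variables (k : finFieldType) (hT : finGroupType) (D : triangular_data k hT).
Local Notation A := (triA D).
Local Notation hA := (@hA k hT D).
Local Notation jA := (@jA k hT D).
Local Notation pr := (@kHproj k hT D).
Local Notation U := {unit triA D}.
Implicit Types (e f u v c : A) (g : U * U).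

Definition toA (u : U) : A := val u.

Lemma toA1 : toA 1%g = 1. Proof. by []. Qed.
Lemma toAM (u v : U) : toA (u * v)%g = toA u * toA v. Proof. by []. Qed.
Lemma toAV (u : U) : toA u * toA u^-1%g = 1.
Proof. by rewrite -toAM mulgV. Qed.
Lemma toAVl (u : U) : toA u^-1%g * toA u = 1.
Proof. by rewrite -toAM mulVg. Qed.
Lemma toA_inj : injective toA. Proof. exact: val_inj. Qed.
Lemma toA_tunit h x : toA (tunit h x) = hA h + jA x. Proof. by []. Qed.
Lemma toAVC e (u : U) : e * toA u = toA u * e ->
  e * toA u^-1%g = toA u^-1%g * e.
Proof.
move=> eu; rewrite -[LHS]mul1r -(toAVl u) -mulrA [toA u * _]mulrA -eu.
by rewrite -[e * _ * _]mulrA toAV mulr1.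
Qed.

Lemma triG_unit c h : pr c = hA h -> exists2 u : U, u \in triG D & toA u = c.
Proof.
move=> ch; exists (tunit h (pJ c)); first exact: imset2_f.
by rewrite toA_tunit -ch -kHproj_split.
Qed.

Lemma triG_proj (u : U) : u \in triG D -> exists h, pr (toA u) = hA h.
Proof.
case/imset2P=> h x _ _ ->; exists h.
by rewrite toA_tunit kHprojD kHproj_jA addr0 kHproj_hA.
Qed.

(* The pairs (ta, tb) attached to the triples (t, a, b). *)
Definition twin e : {set U * U} :=
  [set g | [&& g.1 \in triG D, g.2 \in triG D,
    pr (toA g.1) == pr (toA g.2),
    e * toA g.1 == toA g.1 * e & e * toA g.2 == toA g.2 * e]].

Fact twin_group_set e : group_set (twin e).
Proof.
apply/group_setP; split; first by rewrite inE !group1 /= !mulr1 !mul1r !eqxx.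
move=> [u v] [u' v']; rewrite !inE /=.
move=> /and5P[Gu Gv /eqP uv /eqP eu /eqP ev].
move=> /and5P[Gu' Gv' /eqP uv' /eqP eu' /eqP ev'].
rewrite !groupM //= !kHprojM uv uv' eqxx /=; apply/andP.
by split; apply/eqP/commrM.
Qed.
Canonical twin_group e := Group (twin_group_set e).

Lemma twinP e (u v : U) :
  reflect [/\ u \in triG D, v \in triG D, pr (toA u) = pr (toA v),
              e * toA u = toA u * e & e * toA v = toA v * e]
          ((u, v) \in twin e).
Proof.
rewrite inE; apply: (iffP and5P) => /= -[-> ->].
  by move=> /eqP uv /eqP eu /eqP ev.
by move=> /eqP uv /eqP eu /eqP ev.
Qed.

Lemma twin_sub1 e : twin e \subset twin 1.
Proof.
apply/subsetP => g; rewrite !inE => /and5P[-> -> -> _ _].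
by rewrite !mulr1 !mul1r !eqxx.
Qed.

Lemma twin1P (u v : U) :
  reflect [/\ u \in triG D, v \in triG D & pr (toA u) = pr (toA v)]
          ((u, v) \in twin 1).
Proof.
rewrite inE /= !mulr1 !mul1r !eqxx !andbT.
by apply: (iffP and3P) => -[-> -> /eqP].
Qed.

(* u' = e u e + h (1 - e), where h is the component of u in H. *)
Lemma cut_unit e (u : U) : e \in idemH D -> u \in triG D ->
  exists u' : U, [/\ u' \in triG D, pr (toA u') = pr (toA u),
    e * toA u' = e * toA u * e, toA u' * e = e * toA u * e
    & (1 - e) * toA u' = pr (toA u) * (1 - e)
      /\ toA u' * (1 - e) = pr (toA u) * (1 - e)].
Proof.
move=> He Gu; have [ee pe] := idemHP _ He; have [h uh] := triG_proj Gu.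
have eh : e * hA h = hA h * e by rewrite -kHproj_hA idemH_comm.
have e1 : e * (1 - e) = 0 by rewrite mulrBr mulr1 ee subrr.
have e1' : (1 - e) * e = 0 by rewrite mulrBl mul1r ee subrr.
have e11 : (1 - e) * (1 - e) = 1 - e by rewrite mulrBr mulr1 e1' subr0.
have h1 : hA h * (1 - e) = (1 - e) * hA h.
  by rewrite mulrBr mulrBl mulr1 mul1r eh.
have prcut : pr (e * toA u * e + hA h * (1 - e)) = hA h.
  rewrite kHprojD !kHprojM kHprojB pe uh kHproj1 kHproj_hA eh -mulrA ee.
  by rewrite -mulrDr addrC subrK mulr1.
have [u' Gu' u'E] := triG_unit prcut.
exists u'; rewrite u'E uh prcut; split=> //; last split.
- by rewrite mulrDr h1 !mulrA e1 mul0r addr0 ee.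
- by rewrite mulrDl -[hA h * _ * e]mulrA e1' mulr0 addr0 -!mulrA ee.
- by rewrite mulrDr h1 !mulrA e1' !mul0r add0r e11.
- by rewrite mulrDl -!mulrA e1 !mulr0 add0r e11.
Qed.

(** Common abstraction of [J], its dual and [A], so that orbits and corners are studied once for all
    three. *)
Record bimodule (M : zmodType) := Bimodule {
  lmod : A -> M -> M;
  rmod : M -> A -> M;
  lmodA : forall u v m, lmod (u * v) m = lmod u (lmod v m);
  rmodA : forall u v m, rmod m (u * v) = rmod (rmod m u) v;
  lrmod : forall u v m, rmod (lmod u m) v = lmod u (rmod m v);
  lmod1 : forall m, lmod 1 m = m;
  rmod1 : forall m, rmod m 1 = m;
  lmodBl : forall u v m, lmod (u - v) m = lmod u m - lmod v m;
  rmodBr : forall u v m, rmod m (u - v) = rmod m u - rmod m v;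
  lmod0 : forall u, lmod u 0 = 0;
  rmod0 : forall u, rmod 0 u = 0 }.

(** * Orbits, corners and regular elements of a bimodule *)

Section Action.
Variables (M : finZmodType) (B : bimodule M).
Local Notation L := (lmod B).
Local Notation R := (rmod B).
Implicit Types m : M.

(** The right action of [(u, v)] sends [m] to [u^-1 m v], the inverse of the left action in the
    definition of [rho]; the orbits are the same. *)
Definition twin_act m (g : U * U) := L (toA (g.1^-1)%g) (R m (toA g.2)).

Fact twin_act_is_action : is_action [set: U * U] twin_act.
Proof.
apply: is_total_action => [m|m g g']; rewrite /twin_act /=.
  by rewrite invg1 toA1 lmod1 rmod1.
by rewrite invMg !toAM lmodA rmodA -lrmod.
Qed.
Canonical twin_action := Action twin_act_is_action.

Definition corner e : {set M} := [set m | (L e m == m) && (R m e == m)].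

Lemma cornerP e m : reflect (L e m = m /\ R m e = m) (m \in corner e).
Proof. by rewrite inE; apply: (iffP andP) => [[/eqP? /eqP?]|[-> ->]]. Qed.

Definition regular e m := (m \in corner e) &&
  [forall f in Acorner e, (f \in idem D) && (f != e) ==> (m \notin corner f)].

Lemma notregularP e m : e * e = e -> m \in corner e ->
  reflect (exists f : A, [/\ e * f = f, f * e = f, f * f = f, f != e
                          & m \in corner f])
          (~~ regular e m).
Proof.
move=> ee Cm; rewrite /regular Cm /= negb_forall.
apply: (iffP existsP) => -[f].
  rewrite 2!negb_imply negbK => /andP[/imsetP[a _ fa] /andP[/andP[]]].
  rewrite inE => /eqP ff neq_fe Cf.
  have fE : (f : A) = e * (a : A) * e := fa.
  exists f; split=> //; first by rewrite fE !mulrA ee.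
  by rewrite fE -!mulrA ee.
case=> ef fe ff neq_fe Cf; exists f;
  rewrite 2!negb_imply negbK neq_fe Cf inE ff.
by rewrite eqxx !andbT; apply/imsetP; exists f; rewrite ?ef ?fe.
Qed.

Local Notation orb := (orbit twin_action (twin 1)).

Lemma twin_actP m m' (u v : U) :
  (m' == twin_act m (u, v)) = (L (toA u) m' == R m (toA v)).
Proof.
apply/eqP/eqP => [->|E]; rewrite /twin_act /=.
  by rewrite -lmodA toAV lmod1.
by rewrite -E -lmodA toAVl lmod1.
Qed.

Lemma twin_orbitP m m' :
  reflect (exists u v : U, [/\ u \in triG D, v \in triG D,
     pr (toA u) = pr (toA v) & L (toA u) m' = R m (toA v)])
  (m' \in orb m).
Proof.
apply: (iffP orbitP) => [[[u v] /twin1P[Gu Gv uv]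
  /esym/eqP]|[u [v [Gu Gv uv E]]]].
  by rewrite twin_actP => /eqP; exists u, v.
exists (u, v); first exact/twin1P.
by apply/esym/eqP; rewrite twin_actP E.
Qed.

Lemma orb_refl m : m \in orb m. Proof. exact: orbit_refl. Qed.
Lemma orb_sym m m' : (m \in orb m') = (m' \in orb m).
Proof. exact: orbit_sym. Qed.
Lemma orb_trans m m' m'' : m' \in orb m -> m'' \in orb m' -> m'' \in orb m.
Proof. by move=> mm' m'm''; exact: (orbit_trans m'm'' mm'). Qed.

Lemma corner_sub e f : f * e = f -> e * f = f -> corner f \subset corner e.
Proof.
move=> fe ef; apply/subsetP => m /cornerP[fm mf]; apply/cornerP; split.
  by rewrite -fm -lmodA ef.
by rewrite -mf -rmodA fe.
Qed.

Lemma corner_act e m g : g \in twin e -> m \in corner e ->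
  twin_act m g \in corner e.
Proof.
case: g => u v; rewrite inE /= => /and5P[_ _ _ /eqP eu /eqP ev].
case/cornerP=> em me; apply/cornerP; rewrite /twin_act /=; split.
  by rewrite -lmodA toAVC // lmodA -lrmod em.
by rewrite lrmod -rmodA -ev rmodA me.
Qed.

(** Replacing [u] and [v] by their cuts [e u e + h (1 - e)] gives a pair in [twin e]. On the corner
    only [e u e] and [e v e] act, so the orbit equation is required only after compression by
    [e]. *)
Lemma corner_orbitI e m m' (u v : U) : e \in idemH D ->
  m \in corner e -> m' \in corner e ->
  u \in triG D -> v \in triG D -> pr (toA u) = pr (toA v) ->
  L e (L (toA u) m') = R (R m (toA v)) e ->
  m' \in orbit twin_action (twin e) m.
Proof.
move=> He /cornerP[em me] /cornerP[em' m'e] Gu Gv uv E.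
have [u' [Gu' pu' eu' ue' _]] := cut_unit He Gu.
have [v' [Gv' pv' ev' ve' _]] := cut_unit He Gv.
apply/orbitP; exists (u', v').
  by apply/twinP; rewrite eu' ue' ev' ve' pu' pv'.
apply/esym/eqP; rewrite twin_actP -{1}em' -lmodA ue' 2!lmodA em' E.
by rewrite -[X in _ == R X _]me -[X in _ == X]rmodA ev' 2!rmodA me.
Qed.

(** This allows orbits of the various groups [twin e] to be compared inside the orbits of the single
    group [twin 1]. *)
Lemma corner_orbit e m : e \in idemH D -> m \in corner e ->
  orbit twin_action (twin e) m = orb m :&: corner e.
Proof.
move=> He Cm; apply/setP => m'; apply/idP/idP.
  case/orbitP=> g Gg <-; rewrite inE; apply/andP; split.
    by apply: mem_orbit; apply: (subsetP (twin_sub1 e)).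
  exact: corner_act.
rewrite inE => /andP[/twin_orbitP[u [v [Gu Gv uv E]]] Cm'].
apply: (corner_orbitI He Cm Cm' Gu Gv uv).
have [em _] := cornerP _ _ Cm; have [_ m'e] := cornerP _ _ Cm'.
by rewrite E -lrmod em -E lrmod m'e.
Qed.

Lemma card_corner_orbit e (S : {set M}) : e \in idemH D ->
  S \subset corner e ->
  #|[set orb m | m in S]| = #|[set orbit twin_action (twin e) m | m in S]|.
Proof.
move=> He /subsetP SC; rewrite -(@card_in_imset _ _ (fun X => X :&: corner e)).
  rewrite -imset_comp; congr #|pred_of_set _|;
    apply: eq_in_imset => m /SC Cm /=.
  by rewrite (corner_orbit He Cm).
move=> _ _ /imsetP[m /SC Cm ->] /imsetP[m' /SC Cm' ->] /setP/(_ m).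
by rewrite !in_setI orb_refl Cm => /esym/andP[mm' _]; apply/esym/orbit_eqP;
  rewrite orb_sym.
Qed.

Lemma corner_acts e : [acts twin e, on corner e | twin_action].
Proof.
apply/actsP => g Gg m; apply/idP/idP; last exact: corner_act.
by move/(corner_act (groupVr Gg));
  rewrite -[twin_act _ _]/(twin_action _ _) actK.
Qed.

(* A power of z is idempotent, and e minus it still fixes m on both sides. *)
Lemma regular_annihilator e m z : e \in idemH D -> regular e m ->
  e * z = z -> z * e = z -> L z m = 0 -> R m z = 0 -> pr z = 0.
Proof.
move=> He /andP[Cm /forall_inP reg] ez ze zm mz.
have [ee pe] := idemHP _ He; have [em me] := cornerP _ _ Cm.
have [n n0 zn] := idem_exp z.
have ezn : e * z ^+ n = z ^+ n by rewrite -(prednK n0) exprS mulrA ez.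
have zne : z ^+ n * e = z ^+ n by rewrite -(prednK n0) exprSr -mulrA ze.
pose f := e - z ^+ n.
have fe : f * e = f by rewrite mulrBl ee zne.
have ef : e * f = f by rewrite mulrBr ee ezn.
have ff : f * f = f by rewrite {1}/f mulrBl ef mulrBr zne zn subrr subr0.
have Cf : m \in corner f.
  apply/cornerP; rewrite lmodBl rmodBr em me -(prednK n0); split.
    by rewrite exprSr lmodA zm lmod0 subr0.
  by rewrite exprS rmodA mz rmod0 subr0.
have : f \in Acorner e by apply/imsetP; exists f => //; rewrite ef fe.
move/reg; rewrite inE ff eqxx Cf /= implybF negbK => /eqP fE.
have /eqP : f - e = 0 by rewrite fE subrr.
rewrite /f addrAC subrr sub0r oppr_eq0 => /eqP zn0.
by apply: (@kHproj_reduced _ _ _ z n); rewrite -kHprojX zn0.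
Qed.

(** If [u m' = m v], the conjugates of [1 - e] by [u] and by [v] annihilate [m'] on the left and on
    the right. Their product compressed by [f] annihilates the regular element [m'] on both sides,
    so its projection [f * (1 - e)] vanishes. *)
Lemma regular_le e f m m' : e \in idemH D -> f \in idemH D ->
  m \in corner e -> regular f m' -> m' \in orb m -> f * e = f.
Proof.
move=> He Hf Cm Rm' /twin_orbitP[u [v [Gu Gv uv E]]].
have [ee pe] := idemHP _ He; have [ff pf] := idemHP _ Hf.
have [em me] := cornerP _ _ Cm.
have /cornerP[fm' m'f] : m' \in corner f by case/andP: Rm'.
pose p1 := toA u^-1%g * (1 - e) * toA u.
pose p2 := toA v^-1%g * (1 - e) * toA v.
have p1m : L p1 m' = 0.
  rewrite /p1 2!lmodA E -lrmod lmodBl lmod1 em subrr rmod0 lmod0 //.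
have m'p2 : R m' p2 = 0.
  have -> : m' = L (toA u^-1%g) (R m (toA v)) by rewrite -E -lmodA toAVl lmod1.
  rewrite lrmod -rmodA !mulrA toAV mul1r rmodA rmodBr rmod1 me subrr.
  by rewrite rmod0 lmod0.
have pe1 : pr (1 - e) = 1 - e by rewrite kHprojB pe.
have prp (w : U) : pr (toA w^-1%g * (1 - e) * toA w) = 1 - e.
  rewrite !kHprojM [X in X * _]kHprojC -mulrA -kHprojM toAVl kHproj1 mulr1.
  exact: pe1.
(* The order [p2 * p1] matters: acting on the left, [p1] meets [m'] first; acting on the right, [p2]
   does. *)
have z0 : pr (f * p2 * p1 * f) = 0.
  apply: (regular_annihilator Hf Rm').
  - by rewrite !mulrA ff.
  - by rewrite -!mulrA ff.
  - by rewrite 2!lmodA fm' p1m lmod0.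
  - by rewrite -2!mulrA rmodA m'f rmodA m'p2 rmod0.
have e1 : (1 - e) * (1 - e) = 1 - e.
  by rewrite mulrBl mul1r mulrBr mulr1 ee subrr subr0.
have fe1 : f * (1 - e) = (1 - e) * f by rewrite -pe1 idemH_comm.
move: z0; rewrite kHprojM [pr (f * p2 * p1)]kHprojM [pr (f * p2)]kHprojM pf
  !prp.
rewrite -[f * _ * _]mulrA e1 fe1 -mulrA ff -fe1 mulrBr mulr1.
by move/eqP; rewrite subr_eq0 => /eqP.
Qed.

Lemma regular_uniq e f m m' : e \in idemH D -> f \in idemH D ->
  regular e m -> regular f m' -> m' \in orb m -> e = f.
Proof.
move=> He Hf Rm Rm' mm'.
have Cm : m \in corner e by case/andP: Rm.
have Cm' : m' \in corner f by case/andP: Rm'.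
rewrite -(regular_le He Hf Cm Rm' mm') idemHK //.
by rewrite (regular_le Hf He Cm' Rm) // orb_sym.
Qed.

(* c = pr f * f + (1 - pr f) * (1 - f) lies in 1 + J and conjugates f to pr f. *)
Lemma not_regular_orbit e m : e \in idemH D -> m \in corner e ->
  ~~ regular e m ->
  exists f m', [/\ f \in idemH D, f * e = f, f != e, m' \in corner f
                 & m' \in orb m].
Proof.
move=> He Cm; have [ee pe] := idemHP _ He.
move=> /(notregularP ee Cm)[f [e_f f_e ff fe /cornerP[fm mf]]].
have Hpf := idemH_proj ff; have [pp _] := idemHP _ Hpf.
pose c := pr f * f + (1 - pr f) * (1 - f).
have prc : pr c = hA 1%g.
  rewrite hA1 kHprojD !kHprojM !kHprojB kHproj1 kHproj_id pp.
  rewrite mulrBr mulr1 [(1 - pr f) * pr f]mulrBl mul1r pp subrr subr0.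
  by rewrite addrC subrK.
have cf : c * f = pr f * c.
  rewrite [LHS]mulrDl [RHS]mulrDr -!mulrA ff [(1 - f) * f]mulrBl mul1r ff subrr
    mulr0.
  rewrite addr0 [pr f * (pr f * f)]mulrA pp [pr f * (_ * _)]mulrA.
  by rewrite [pr f * (1 - _)]mulrBr mulr1 pp subrr mul0r addr0.
have [u Gu uc] := triG_unit prc.
have fcV : f * toA u^-1%g = toA u^-1%g * pr f.
  rewrite -[LHS]mul1r -(toAVl u) -mulrA [toA u * _]mulrA uc cf.
  by rewrite -[pr f * _ * _]mulrA -uc toAV mulr1.
exists (pr f), (L c (R m (toA u^-1%g))); split=> //.
- by have := congr1 pr f_e; rewrite kHprojM pe.
(* If [pr f = e], then [e - f] is an idempotent of the nil ideal [J], hence zero. *)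
- apply: contra fe => /eqP pfe; rewrite eq_sym -subr_eq0; apply/eqP.
  have idef : (e - f) * (e - f) = e - f.
    by rewrite mulrBl !mulrBr ee ff f_e e_f subrr subr0.
  have [n n0] : exists n, (e - f) ^+ n = 0.
    by apply: kHproj0_nil; rewrite kHprojB pe pfe subrr.
  have : forall n, (e - f) ^+ n.+1 = e - f.
    by elim=> [|i IHi]; rewrite ?expr1 // exprS IHi idef.
  by move/(_ n) <-; rewrite exprS n0 mulr0.
- apply/cornerP; split.
    by rewrite -lmodA -cf lmodA -lrmod fm.
  by rewrite lrmod -rmodA -fcV rmodA mf.
- apply/twin_orbitP; exists (u^-1)%g, (u^-1)%g; rewrite groupV; split=> //.
  by rewrite -uc -lmodA toAVl lmod1.
Qed.

(** The size of [e A e] serves as the measure for the inductions on idempotents. *)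
Lemma Acorner_lt e f : e \in idemH D -> f \in idemH D -> f * e = f ->
  f != e -> (#|Acorner f| < #|Acorner e|)%N.
Proof.
move=> He Hf fe neq_fe; have [ff _] := idemHP _ Hf; have [ee _] := idemHP _ He.
have ef : e * f = f by rewrite idemHK.
apply/proper_card/properP; split.
  apply/subsetP => _ /imsetP[a _ ->]; apply/imsetP; exists (f * a * f) => //.
  by rewrite !mulrA ef -!mulrA fe.
exists e; first by apply/imsetP; exists e => //; rewrite !ee.
apply: contra neq_fe => /imsetP[a _ eE].
by rewrite -fe eE !mulrA ff.
Qed.

(** Descent: a non-regular element is moved by [not_regular_orbit] to the corner of a strictly
    smaller idempotent of kH. *)
Lemma exists_regular e m : e \in idemH D -> m \in corner e ->
  exists f m', [/\ f \in idemH D, f * e = f, regular f m' & m' \in orb m].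
Proof.
have [n] := ubnP #|Acorner e|; elim: n e m => // n IHn e m le_n He Cm.
have [Rm|Rm] := boolP (regular e m).
  by exists e, m; split=> //; [case/idemHP: He | exact: orb_refl].
have [f [m' [Hf fe neq_fe Cm' mm']]] := not_regular_orbit He Cm Rm.
have lt_f : (#|Acorner f| < n)%N.
  by rewrite -ltnS (leq_trans _ le_n) // ltnS Acorner_lt.
have [f' [m'' [Hf' f'f Rm'' m'm'']]] := IHn f m' lt_f Hf Cm'.
exists f', m''; split=> //; first by rewrite -f'f -mulrA fe.
exact: orb_trans m'm''.
Qed.

(** Were [m'] not regular, the orbit would meet the corner of some [f < e], whereas the regular
    element [m] forces [e <= f]. *)
Lemma regular_orbit e m m' : e \in idemH D -> regular e m -> m' \in orb m ->
  m' \in corner e -> regular e m'.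
Proof.
move=> He Rm mm' Cm'; apply/negPn/negP => nR.
have [f [m1 [Hf fe neq_fe Cm1 m'm1]]] := not_regular_orbit He Cm' nR.
case/eqP: neq_fe; rewrite -(regular_le Hf He Cm1 Rm); first by rewrite idemHK.
by rewrite orb_sym (orb_trans mm').
Qed.

Definition regular_orbits e := [set orb m | m in [set m | regular e m]].

(** Each orbit meeting the corner of [e] contains a regular element for some [f <= e] by
    [exists_regular], and for only one such [f] by [regular_uniq]; the orbits are counted according
    to this [f]. *)
Lemma card_corner_orbits e : e \in idemH D ->
  #|[set orb m | m in corner e]|
  = \sum_(f in idemH D | f * e == f) #|regular_orbits f|.
Proof.
move=> He.
pose F f := (f \in idemH D) && (f * e == f).
(* [g] assigns to an orbit its idempotent; the default 0 is not reached on orbits meeting the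
   corner. *)
pose g X := odflt 0 [pick f | F f && (X \in regular_orbits f)].
have inS f X : F f -> X \in regular_orbits f ->
    X \in [set orb m | m in corner e] /\ g X = f.
  move=> /[dup] Ff /andP[Hf /eqP fe] /imsetP[m]; rewrite inE => Rm XE; split.
    have ef : e * f = f by rewrite idemHK.
    apply/imsetP; exists m => //; apply: (subsetP (corner_sub fe ef)).
    by case/andP: Rm.
  rewrite /g; case: pickP => [f' /andP[/andP[Hf' _]]|/(_ f)]; last first.
    by rewrite Ff XE imset_f // inE.
  case/imsetP=> m'; rewrite inE => Rm' XE'.
  by apply: (regular_uniq Hf' Hf Rm' Rm); rewrite -XE' XE orb_refl.
rewrite -sum1_card (partition_big g F) => [|X /imsetP[m Cm ->]]; last first.
  have [f [m' [Hf fe Rm' mm']]] := exists_regular He Cm.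
  have Ff : F f by rewrite /F Hf fe eqxx.
  suff /(inS _ _ Ff)[_ ->] : orb m \in regular_orbits f by [].
  by apply/imsetP; exists m'; rewrite ?inE //; apply/esym/orbit_eqP.
apply: eq_bigr => f Ff; rewrite -sum1_card; apply: eq_bigl => X.
apply/andP/idP => [[/imsetP[m Cm XE]]|/(inS _ _ Ff)[-> ->]//].
have [f' [m' [Hf' fe' Rm' mm']]] := exists_regular He Cm.
have Ff' : F f' by rewrite /F Hf' fe' eqxx.
have XS : X \in regular_orbits f'.
  by apply/imsetP; exists m'; rewrite ?inE // XE; apply/esym/orbit_eqP.
by have [_ ->] := inS _ _ Ff' XS => /eqP <-.
Qed.
End Action.
End Twin.

(** * Duality through additive characters *)

(** Translation by [x] permutes the terms and multiplies the sum by [f x], which is not 1. *)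
Lemma sum_morph_eq0 (V : finZmodType) (F : idomainType) (f : V -> F) x :
  {morph f : y z / y + z >-> y * z} -> f x != 1 -> \sum_y f y = 0.
Proof.
move=> fD fx; have : (f x - 1) * \sum_y f y = 0.
  rewrite mulrBl mul1r mulr_sumr [X in _ - X](reindex_inj (addrI x)) /=.
  by rewrite -sumrB big1 // => y _; rewrite fD subrr.
by move/eqP; rewrite mulf_eq0 subr_eq0 (negPf fx) => /eqP.
Qed.

Section Duality.
Variables (k : finFieldType) (hT : finGroupType) (D : triangular_data k hT).
Variable eps : nontrivial_addchar k.
Local Notation J := (triJ D).
Local Notation Jd := (triJdual D).

Lemma dual_linfunE (f : J -> k^o) : linear f -> (linfun f : Jd) =1 f.
Proof.
move=> fP x; pose m := GRing.isLinear.Build k J k^o *:%R f fP.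
pose g : {linear J -> k^o} := HB.pack f m.
exact: (lfunE g).
Qed.

Lemma dual_separates (x : J) : x != 0 -> exists l : Jd, l x != 0.
Proof.
move=> x0; pose b := vbasis {:J}.
have [i bi|b0] := pickP (fun i => coord b i x != 0).
  exists (linfun (fun y => coord b i y : k^o)).
  by rewrite dual_linfunE // => c y z; rewrite linearP.
case/eqP: x0; rewrite (coord_vbasis (memvf x)) big1 // => i _.
by have := b0 i; case: eqP => // ->; rewrite scale0r.
Qed.

(** The image of [f] is closed under scaling, so if [f] is nonzero it takes a value on which [eps]
    is nontrivial, and the sum runs over a nontrivial character. *)
Lemma sum_addchar (V : finZmodType) (f : V -> k) :
  {morph f : y z / y + z} -> (forall c x, exists y, f y = c * f x) ->
  \sum_x eps (f x) = if [forall x, f x == 0] then #|V|%:R else 0.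
Proof.
move=> fD fZ; case: ifP => [/forallP f0|/negbT].
  rewrite -[RHS]sumr_const; apply: eq_bigr => x _; rewrite (eqP (f0 x)).
  exact: addchar0.
case/forallPn=> x fx0; have [t et] := addchar_neq1 eps.
have [y fy] := fZ (t / f x) x; apply: (@sum_morph_eq0 _ _ _ y).
  by move=> u v; rewrite fD addcharD.
by rewrite fy divfK.
Qed.

(** Both sides evaluate the double sum of [eps (l (phi x))]: summing over [l] first leaves the [x]
    in the kernel, since linear forms separate points; summing over [x] first leaves the [l] that
    vanish on the image. *)
Lemma card_ker_annihilator (phi : J -> J) : linear phi ->
  (#|[set x | phi x == 0%R]| * #|Jd|)%N
  = (#|[set l : Jd | [forall x, l (phi x) == 0%R]]| * #|J|)%N.
Proof.
move=> phiP.
have E0 (V : finType) (P : pred V) n :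
    \sum_(x : V) (if P x then n%:R else 0) = (#|[set x | P x]| * n)%:R :> algC.
  rewrite -big_mkcond -(eq_bigl _ _ (in_set P)) sumr_const.
  by rewrite natrM mulr_natl.
apply/eqP; rewrite -(eqC_nat); apply/eqP.
rewrite -!E0.
have phiD x y : phi (x + y) = phi x + phi y.
  by have := phiP 1 x y; rewrite !scale1r.
have phi0 : phi 0 = 0 by apply: (addrI (phi 0)); rewrite -phiD !addr0.
have phiZ c x : phi (c *: x) = c *: phi x.
  by have := phiP c x 0; rewrite phi0 !addr0.
transitivity (\sum_(x : J) \sum_(l : Jd) eps (l (phi x))); last first.
  rewrite exchange_big; apply: eq_bigr => l _.
  apply: sum_addchar => [x y|c x]; first by rewrite phiD linearD.
  by exists (c *: x); rewrite phiZ linearZ.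
apply: eq_bigr => x _; rewrite sum_addchar => [|l l'|c l]; last 2 first.
- by rewrite lfunE.
- by exists (c *: l); rewrite lfunE.
congr (if _ then _ else _); apply/eqP/forallP => [->|H].
  by move=> l; rewrite linear0.
apply/eqP/negPn/negP => /dual_separates[l].
by rewrite (eqP (H l)) eqxx.
Qed.

Lemma card_dual : #|Jd| = #|J|.
Proof.
have /card_ker_annihilator : linear (@id J) by [].
have -> : [set x : J | x == 0] = [set 0] by apply/setP => x; rewrite !inE.
have -> : [set l : Jd | [forall x : J, l x == 0]] = [set 0].
  apply/setP => l; rewrite !inE; apply/forallP/eqP => [H|-> x].
    by apply/lfunP => x; rewrite lfunE (eqP (H x)).
  by rewrite lfunE.
by rewrite !cards1 !mul1n.
Qed.

Lemma card_ker_dual (phi : J -> J) : linear phi ->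
  #|[set x | phi x == 0]| = #|[set l : Jd | [forall x, l (phi x) == 0]]|.
Proof.
move=> /card_ker_annihilator/eqP; rewrite card_dual eqn_pmul2r => [/eqP//|].
by apply/card_gt0P; exists 0.
Qed.

End Duality.

(** * Orbits on J and on its dual *)

Section OrbitCount.
Variables (k : finFieldType) (hT : finGroupType) (D : triangular_data k hT).
Local Notation A := (triA D).
Local Notation J := (triJ D).
Local Notation Jd := (triJdual D).
Local Notation hA := (@hA k hT D).
Local Notation jA := (@jA k hT D).
Local Notation pr := (@kHproj k hT D).
Local Notation U := {unit triA D}.
Implicit Types (e f : A) (x y : J) (l : Jd) (g : U * U).

Definition lmulJ (u : A) x : J := pJ (u * jA x).
Definition rmulJ x (u : A) : J := pJ (jA x * u).

Lemma jA_lmulJ (u : A) x : jA (lmulJ u x) = u * jA x.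
Proof. by rewrite jA_pJ // mul1E conv0. Qed.
Lemma jA_rmulJ (u : A) x : jA (rmulJ x u) = jA x * u.
Proof. by rewrite jA_pJ // mul1E conv0l. Qed.
Lemma jA_inj : injective jA. Proof. by move=> x y []. Qed.
Lemma jAZ c x : jA (c *: x) = c *: jA x.
Proof. by congr pair; rewrite scaler0. Qed.
Lemma jAB x y : jA (x - y) = jA x - jA y.
Proof. by congr pair; rewrite subr0. Qed.

Lemma lmulJA (u v : A) x : lmulJ (u * v) x = lmulJ u (lmulJ v x).
Proof. by apply: jA_inj; rewrite !jA_lmulJ mulrA. Qed.
Lemma rmulJA (u v : A) x : rmulJ x (u * v) = rmulJ (rmulJ x u) v.
Proof. by apply: jA_inj; rewrite !jA_rmulJ mulrA. Qed.
Lemma lrmulJ (u v : A) x : rmulJ (lmulJ u x) v = lmulJ u (rmulJ x v).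
Proof. by apply: jA_inj; rewrite jA_rmulJ !jA_lmulJ jA_rmulJ mulrA. Qed.
Lemma lmulJ1 x : lmulJ 1 x = x.
Proof. by apply: jA_inj; rewrite jA_lmulJ mul1r. Qed.
Lemma rmulJ1 x : rmulJ x 1 = x.
Proof. by apply: jA_inj; rewrite jA_rmulJ mulr1. Qed.
Lemma lmulJBl (u v : A) x : lmulJ (u - v) x = lmulJ u x - lmulJ v x.
Proof. by apply: jA_inj; rewrite jAB !jA_lmulJ mulrBl. Qed.
Lemma rmulJBr (u v : A) x : rmulJ x (u - v) = rmulJ x u - rmulJ x v.
Proof. by apply: jA_inj; rewrite jAB !jA_rmulJ mulrBr. Qed.
Lemma lmulJP (u : A) c x y : lmulJ u (c *: x + y) = c *: lmulJ u x + lmulJ u y.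
Proof. by apply: jA_inj; rewrite jA_lmulJ 2!jAD 2!jAZ !jA_lmulJ mulrDr
  scalerAr. Qed.
Lemma rmulJP (u : A) c x y : rmulJ (c *: x + y) u = c *: rmulJ x u + rmulJ y u.
Proof. by apply: jA_inj; rewrite jA_rmulJ 2!jAD 2!jAZ !jA_rmulJ mulrDl
  scalerAl. Qed.
Lemma lmulJ0 (u : A) : lmulJ u 0 = 0.
Proof. by apply: jA_inj; rewrite jA_lmulJ mulr0. Qed.
Lemma rmulJ0 (u : A) : rmulJ 0 u = 0.
Proof. by apply: jA_inj; rewrite jA_rmulJ mul0r. Qed.

Lemma pJ_lr (u v : A) x : pJ (u * jA x * v) = lmulJ u (rmulJ x v).
Proof. by rewrite /lmulJ jA_rmulJ mulrA. Qed.

Definition bimodJ : bimodule D J := Bimodule lmulJA rmulJA lrmulJ lmulJ1 rmulJ1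
  lmulJBl rmulJBr lmulJ0 rmulJ0.

Definition lmulD (u : A) l : Jd := linfun (fun x => l (rmulJ x u)).
Definition rmulD l (u : A) : Jd := linfun (fun x => l (lmulJ u x)).

Lemma lmulDE u l x : lmulD u l x = l (rmulJ x u).
Proof. by rewrite dual_linfunE // => c y z; rewrite rmulJP linearP. Qed.
Lemma rmulDE u l x : rmulD l u x = l (lmulJ u x).
Proof. by rewrite dual_linfunE // => c y z; rewrite lmulJP linearP. Qed.

Lemma lmulDA (u v : A) l : lmulD (u * v) l = lmulD u (lmulD v l).
Proof. by apply/lfunP => x; rewrite !lmulDE rmulJA. Qed.
Lemma rmulDA (u v : A) l : rmulD l (u * v) = rmulD (rmulD l u) v.
Proof. by apply/lfunP => x; rewrite !rmulDE lmulJA. Qed.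
Lemma lrmulD (u v : A) l : rmulD (lmulD u l) v = lmulD u (rmulD l v).
Proof. by apply/lfunP => x; rewrite rmulDE !lmulDE rmulDE lrmulJ. Qed.
Lemma lmulD1 l : lmulD 1 l = l.
Proof. by apply/lfunP => x; rewrite lmulDE rmulJ1. Qed.
Lemma rmulD1 l : rmulD l 1 = l.
Proof. by apply/lfunP => x; rewrite rmulDE lmulJ1. Qed.
Lemma lmulDBl (u v : A) l : lmulD (u - v) l = lmulD u l - lmulD v l.
Proof. by apply/lfunP => x; rewrite !(lmulDE, lfunE) /= !lfunE /=
  !lmulDE rmulJBr linearB. Qed.
Lemma rmulDBr (u v : A) l : rmulD l (u - v) = rmulD l u - rmulD l v.
Proof. by apply/lfunP => x; rewrite !(rmulDE, lfunE) /= !lfunE /=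
  !rmulDE lmulJBl linearB. Qed.
Lemma lmulD0 (u : A) : lmulD u 0 = 0.
Proof. by apply/lfunP => x; rewrite lmulDE !lfunE. Qed.
Lemma rmulD0 (u : A) : rmulD 0 u = 0.
Proof. by apply/lfunP => x; rewrite rmulDE !lfunE. Qed.

Definition bimodD : bimodule D Jd := Bimodule lmulDA rmulDA lrmulD lmulD1 rmulD1
  lmulDBl rmulDBr lmulD0 rmulD0.

Lemma cornerJ e : e * e = e -> Jcorner e = corner bimodJ e.
Proof.
move=> ee; apply/setP => x; apply/imsetP/cornerP => [[y _ ->]|[/= ex xe]].
  by rewrite pJ_lr; split=> /=; rewrite -?lmulJA -?lrmulJ -?rmulJA ee.
by exists x => //; have := pJ_lr e e x; rewrite xe ex => /esym.
Qed.

(** A form satisfying [e l = l] kills every [x (1 - e)], and one satisfying [l e = l] kills every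
    [(1 - e) x]; this covers the three Peirce components other than [e J e]. *)
Lemma cornerD e : e * e = e -> Jdual e = corner bimodD e.
Proof.
move=> ee; apply/setP => l; apply/idP/cornerP => /= [Hl|[el le]].
  have lE x : l x = l (lmulJ e (rmulJ x e)).
    by rewrite (Jdual_corner _ Hl) pJ_lr.
  split; apply/lfunP => x; rewrite ?lmulDE ?rmulDE.
    by rewrite lE -rmulJA ee -lE.
  by rewrite lE -lrmulJ -lmulJA ee lrmulJ -lE.
have lE1 x : l (rmulJ x (1 - e)) = 0.
  by rewrite -{1}el lmulDE -rmulJA mulrBl mul1r ee subrr /rmulJ mulr0 linear0.
have lE2 x : l (lmulJ (1 - e) x) = 0.
  by rewrite -{1}le rmulDE -lmulJA mulrBr mulr1 ee subrr /lmulJ mul0r linear0.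
rewrite inE; apply/forallP => x.
by rewrite !pJ_lr -!lrmulJ !lE1 lrmulJ lE2 eqxx.
Qed.

Lemma regularJE e x : e * e = e -> regularJ e x = regular bimodJ e x.
Proof.
move=> ee; rewrite /regularJ /regular cornerJ //; congr (_ && _).
apply: eq_forallb => f; rewrite inE; case: (f \in Acorner e) => //=.
by case: eqP => //= ff; rewrite cornerJ.
Qed.

Lemma regularDE e l : e * e = e -> regularJdual e l = regular bimodD e l.
Proof.
move=> ee; rewrite /regularJdual /regular cornerD //; congr (_ && _).
apply: eq_forallb => f; rewrite inE; case: (f \in Acorner e) => //=.
by case: eqP => //= ff; rewrite cornerD.
Qed.

(* The pair g of twin e has the same action on J_e as the triple s. *)
Definition companion e (s : A * A * A) g :=
  [/\ g \in twin e, e * toA g.1 = s.1.1 * s.1.2 & e * toA g.2 = s.1.1 * s.2].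

Lemma exists_companion e s : e \in idemH D -> s \in Gtilde e ->
  exists g, companion e s g.
Proof.
case: s => [[t a] b] He; have [ee pe] := idemHP _ He.
rewrite !in_setX /= => /andP[/andP[/imsetP[h _ ->]]].
case/imsetP=> x Jx -> /imsetP[y Jy ->].
have eh : e * hA h = hA h * e by rewrite idemHC.
(* For [t = h e], [a = e + x], [b = e + y] the pair is [h (1 + x)], [h (1 + y)]. *)
exists (tunit h (lacth h x), tunit h (lacth h y)); rewrite /companion /=.
have E z : z \in Jcorner e -> e * (hA h + hA h * jA z) = hA h * e * (e + jA z)
    /\ (hA h + hA h * jA z) * e = hA h * e * (e + jA z).
  move=> Jz; have [ez ze] := (eJ He Jz, Je He Jz).
  rewrite !mulrDr mulrDl -!mulrA ee ze ez; split=> //.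
  by rewrite mulrA eh -mulrA ez.
rewrite !toA_tunit -!hA_jA.
have [[-> xe] [-> ye]] := (E _ Jx, E _ Jy); split=> //.
apply/twinP; rewrite !toA_tunit -!hA_jA xe ye !imset2_f //.
rewrite (proj1 (E _ Jx)) (proj1 (E _ Jy)).
by split=> //; rewrite !kHprojD !kHprojM !kHproj_jA !mulr0.
Qed.

Lemma exists_triple e g : e \in idemH D -> g \in twin e ->
  exists2 s, s \in Gtilde e & companion e s g.
Proof.
case: g => u v He /[dup] Gg; have [ee pe] := idemHP _ He.
case/twinP=> /imset2P[h x _ _ uE] /imset2P[h' y _ _ vE].
rewrite uE vE !toA_tunit !kHprojD !kHproj_jA !addr0 !kHproj_hA.
move=> /hA_inj hh'; rewrite -{}hh' in vE * => eu ev.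
have eh i : e * hA i = hA i * e by rewrite idemHC.
have [ex ey] : e * jA x = jA x * e /\ e * jA y = jA y * e.
  by move: eu ev; rewrite !mulrDr !mulrDl eh => /addrI -> /addrI ->.
(* [n z] is chosen so that [e (h + z) = (h e) (n z)]; it recovers [a] and [b] from the pair. *)
pose n z := e + jA (pJ (e * jA (lacth h^-1%g z) * e)).
have nP z : e * jA z = jA z * e -> n z \in Ncorner e /\
    e * (hA h + jA z) = hA h * e * n z.
  move=> ez; split; first by apply: imset_f; apply: imset_f.
  rewrite /n jA_pJ ?corner1 // -hA_jA !mulrDr -[hA h * e * e]mulrA ee eh.
  congr (_ + _); rewrite !mulrA -[hA h * e * e]mulrA ee -eh -[e * hA h *
    _]mulrA.
  by rewrite hAM mulgV hA1 mulr1 -mulrA -ez mulrA ee.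
have [Nx xE] := nP x ex; have [Ny yE] := nP y ey.
exists (hA h * e, n x, n y); last first.
  by split=> //; rewrite -uE -vE.
by rewrite !in_setX Nx Ny !andbT; apply: imset_f.
Qed.

Lemma companion_inv e t a b g : e \in idemH D -> (t, a, b) \in Gtilde e ->
  companion e (t, a, b) g -> cinv e b * cinv e t = e * toA g.2^-1%g.
Proof.
move=> He; rewrite !in_setX /= => /andP[/andP[/imsetP[h _ ->] Na] Nb].
case: g => u v [/= /twinP[_ _ _ _ ev] _ E].
have [ee pe] := idemHP _ He.
have [Gb' bb' b'b] := cinvP He (Nc_Gc Nb).
have [Gt' tt' t't] := cinvP He (hAe_in e h).
have [_ t'e] := Gc_e He Gt'; have [eb _] := Gc_e He (Nc_Gc Nb).
move: (hA h * e) (cinv e (hA h * e)) E t't t'e {tt' Gt'} => r r' E r'r r'e.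
rewrite -[LHS]mulr1 -(toAV v) mulrA; congr (_ * _).
by rewrite -r'e -!mulrA E [r' * _]mulrA r'r eb.
Qed.

Lemma rhoE e s g x : e \in idemH D -> s \in Gtilde e -> companion e s g ->
  rho e s x = lmulJ (toA g.1) (rmulJ (lmulJ e (rmulJ x e)) (toA g.2^-1%g)).
Proof.
case: s => [[t a] b] He Hs C; have W := companion_inv He Hs C.
rewrite /rho -[_ * cinv e b * _]mulrA W pJ_lr.
case: g C {W} => u v [/= /twinP[_ _ _ eu _] <- _].
by rewrite eu lmulJA rmulJA lrmulJ.
Qed.

Lemma twinV e (u v : U) : (u, v) \in twin e -> (u^-1, v^-1)%g \in twin e.
Proof. by move=> Gg; rewrite -[X in X \in _]/((u, v)^-1)%g groupV. Qed.
Lemma twin_swap e (u v : U) : ((u, v) \in twin e) = ((v, u) \in twin e).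
Proof.
by apply/twinP/twinP => -[].
Qed.

Lemma corner_lrJ e x : e * e = e -> x \in corner bimodJ e ->
  lmulJ e (rmulJ x e) = x.
Proof. by move=> ee /cornerP[/= ex xe]; rewrite xe. Qed.

Lemma orbJE e x : e \in idemH D -> x \in corner bimodJ e ->
  orbJ e x = orbit (twin_action bimodJ) (twin e) x.
Proof.
move=> He Cx; have [ee _] := idemHP _ He.
apply/setP => y; apply/imsetP/orbitP => [[s Hs ->]|[[u v] Gg <-]].
  have [[u v] C] := exists_companion He Hs.
  rewrite (rhoE x He Hs C) corner_lrJ //; case: C => Gg _ _.
  by exists (u^-1, v^-1)%g; rewrite ?twinV //= /twin_act /= invgK.
have [s Hs C] := exists_triple He (twinV Gg); exists s => //.
by rewrite (rhoE x He Hs C) corner_lrJ //= invgK.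
Qed.

(** The map from [(t, a, b)] to [(ta, tb)] turns [tmul] into the componentwise product, because
    [t1 a1 t2 a2 = t1 t2 (t2^-1 a1 t2) a2]. *)
Lemma tmul_prod e s r : e \in idemH D -> s \in Gtilde e -> r \in Gtilde e ->
  tmul e s r = (e, e, e) ->
  s.1.1 * s.1.2 * (r.1.1 * r.1.2) = e /\ s.1.1 * s.2 * (r.1.1 * r.2) = e.
Proof.
case: s r => [[t1 a1] b1] [[t2 a2] b2] He; have [ee _] := idemHP _ He.
rewrite !in_setX /= => /andP[/andP[_ Na] Nb] /andP[/andP[/imsetP[h _ ->] _] _].
have [ea _] := Gc_e He (Nc_Gc Na); have [eb _] := Gc_e He (Nc_Gc Nb).
have [_ tt' _] := cinvP He (hAe_in e h).
move: (hA h * e) (cinv e (hA h * e)) tt' => t t' tt'.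
move=> [t1t a1E b1E] /=; split.
  transitivity (t1 * t * (t' * a1 * t * a2)); last by rewrite t1t a1E ee.
  by rewrite -{1}ea -tt' !mulrA.
transitivity (t1 * t * (t' * b1 * t * b2)); last by rewrite t1t b1E ee.
by rewrite -{1}eb -tt' !mulrA.
Qed.

Lemma Gtilde_prod e s : e \in idemH D -> s \in Gtilde e ->
  [/\ e * (s.1.1 * s.1.2) = s.1.1 * s.1.2, s.1.1 * s.1.2 * e = s.1.1 * s.1.2,
      e * (s.1.1 * s.2) = s.1.1 * s.2 & s.1.1 * s.2 * e = s.1.1 * s.2].
Proof.
case: s => [[t a] b] He.
rewrite !in_setX /= => /andP[/andP[/imsetP[h _ ->] Na] Nb].
have [_ ae] := Gc_e He (Nc_Gc Na); have [_ be] := Gc_e He (Nc_Gc Nb).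
have [et _] := Gc_e He (hAe_in e h); move: (hA h * e) et => t0 et0.
by rewrite !mulrA et0 -!mulrA ae be.
Qed.

(** [tinv] is defined by a choice, so the double inverse is compared with [s] only through the
    products [ta] and [tb], both being inverse to those of [tinv e s]. *)
Lemma companion_tinv e s g : e \in idemH D -> s \in Gtilde e ->
  companion e s g -> companion e (tinv e (tinv e s)) g.
Proof.
move=> He Hs [Gg E1 E2].
have [Hr rs] := tinvP He Hs; have [Hr' r'r] := tinvP He Hr.
have [rs1 rs2] := tmul_prod He Hr Hs rs.
have [r'r1 r'r2] := tmul_prod He Hr' Hr r'r.
have [es1 _ es2 _] := Gtilde_prod He Hs.
have [_ er1 _ er2] := Gtilde_prod He Hr'.
split=> //; rewrite ?E1 ?E2.
  by rewrite -[RHS]er1 -[X in _ = _ * X]rs1 [RHS]mulrA r'r1 es1.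
by rewrite -[RHS]er2 -[X in _ = _ * X]rs2 [RHS]mulrA r'r2 es2.
Qed.

(** The number [l (u x v^-1)] is the value at [x] of [v^-1 l u], so on the dual the components of
    the pair are exchanged. *)
Lemma rho_dual_act e s l (u v : U) : e \in idemH D -> s \in Gtilde e ->
  l \in corner bimodD e -> companion e (tinv e s) (u, v) ->
  rho_dual e s l = twin_act bimodD l (v, u).
Proof.
move=> He Hs Cl C; have [Hr _] := tinvP He Hs.
have Gg : (v, u) \in twin e by rewrite twin_swap; case: C.
have /cornerP[/= el le] := corner_act Gg Cl.
apply/lfunP => x; rewrite rho_dualE (rhoE x He Hr C) /=.
by rewrite -{}el -{}le lmulDE rmulDE /twin_act /= lmulDE rmulDE.
Qed.

Lemma orbDE e l : e \in idemH D -> l \in corner bimodD e ->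
  orbJdual e l = orbit (twin_action bimodD) (twin e) l.
Proof.
move=> He Cl; apply/setP => l';
  apply/imsetP/orbitP => [[s Hs ->]|[[u v] Gg <-]].
  have [Hr _] := tinvP He Hs; have [[u v] C] := exists_companion He Hr.
  exists (v, u); first by rewrite twin_swap; case: C.
  exact/esym/rho_dual_act.
rewrite twin_swap in Gg; have [r Hr C] := exists_triple He Gg.
have [Hs _] := tinvP He Hr; exists (tinv e r) => //.
exact/esym/rho_dual_act/companion_tinv.
Qed.

Variable eps : nontrivial_addchar k.

(** The fixed points in [e J e] form the kernel of [x |-> e u^-1 x v e - x], where the factors [e]
    force a fixed point into the corner. The forms vanishing on the image of this map are the fixed
    points of the transposed pair, and the two spaces have equal size by [card_ker_dual]. *)
Lemma card_fix_dual e (u v : U) : e \in idemH D -> (u, v) \in twin e ->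
  #|'Fix_(corner bimodJ e | twin_action bimodJ)[(u, v)]|
  = #|'Fix_(corner bimodD e | twin_action bimodD)[(v^-1, u^-1)%g]|.
Proof.
move=> He Gg; have [ee _] := idemHP _ He.
have [_ _ _ eu ev] := twinP _ _ _ Gg.
pose phi x := lmulJ (e * toA u^-1%g) (rmulJ x (toA v * e)) - x.
have phiP : linear phi.
  move=> c x y; by rewrite /phi rmulJP lmulJP scalerBr opprD addrACA.
transitivity #|[set x | phi x == 0]|.
  apply: eq_card => x; rewrite [LHS]in_setI [RHS]inE.
  apply/andP/idP => [[/cornerP[/= ex xe] /afix1P/= xE]|].
    rewrite subr_eq0 lmulJA rmulJA -[X in lmulJ e X]lrmulJ -[X in _ == X]ex.
    by rewrite -[X in _ == lmulJ e X]xe -{2}xE.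
  rewrite subr_eq0 => /eqP xE.
  have ex : lmulJ e x = x by rewrite -{1}xE -lmulJA mulrA ee.
  have xe : rmulJ x e = x by rewrite -{1}xE lrmulJ -rmulJA -mulrA ee.
  split; first exact/cornerP.
  apply/afix1P; rewrite /= /twin_act /= -[RHS]xE toAVC // -ev lmulJA rmulJA xe.
  by rewrite -[lmulJ e (rmulJ x _)]lrmulJ ex.
rewrite (card_ker_dual eps phiP); apply: eq_card => l;
  rewrite [LHS]inE [RHS]in_setI.
have lE : (forall x, l (phi x) = 0) <->
    lmulD (toA v * e) (rmulD l (e * toA u^-1%g)) = l.
  split=> [H|E x].
    apply/lfunP => x; rewrite lmulDE rmulDE; apply/eqP; rewrite -subr_eq0.
    by rewrite -linearB; apply/eqP/H.
  rewrite /phi linearB; have := congr1 (fun f : Jd => f x) E.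
  by rewrite lmulDE rmulDE => lx; apply/eqP; rewrite subr_eq0; apply/eqP.
apply/forallP/andP => [H|[/cornerP[/= el le] /afix1P/= lE']].
  have /lE E : forall x, l (phi x) = 0 by move=> x; apply/eqP/H.
  have el : lmulD e l = l.
    by rewrite -{1}E -lmulDA -ev mulrA ee ev.
  have le : rmulD l e = l.
    by rewrite -{1}E lrmulD -rmulDA -mulrA -toAVC // mulrA ee toAVC // -toAVC.
  split; first exact/cornerP.
  apply/afix1P; rewrite /= /twin_act /= invgK -[RHS]E lmulDA rmulDA le.
  by rewrite -[lmulD e (rmulD l _)]lrmulD el.
move=> x; apply/eqP; move: x; apply/lE.
rewrite lmulDA rmulDA le -[lmulD e (rmulD l _)]lrmulD el.
by move: lE'; rewrite /twin_act /= invgK.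
Qed.

(** Burnside's formula on both sides, the group being reindexed by the involution that sends
    [(u, v)] to [(v^-1, u^-1)]. *)
Lemma card_corner_dual e : e \in idemH D ->
  #|[set orbit (twin_action bimodJ) (twin 1) m | m in corner bimodJ e]|
  = #|[set orbit (twin_action bimodD) (twin 1) m | m in corner bimodD e]|.
Proof.
move=> He; rewrite !(card_corner_orbit He) //.
apply/eqP; rewrite -(eqn_pmul2r (cardG_gt0 (twin_group e))).
rewrite -!Frobenius_Cauchy ?corner_acts //; apply/eqP.
have swapK : involutive (fun g : U * U => (g.2^-1, g.1^-1)%g).
  by case=> u v /=; rewrite !invgK.
rewrite [RHS](reindex_inj (inv_inj swapK)) /=;
  apply: eq_big => [[u v]|[u v] Gg].
  rewrite /= twin_swap; apply/idP/idP => [|/twinV]; first exact: twinV.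
  by rewrite !invgK.
exact: card_fix_dual.
Qed.

(** The total orbit counts agree, and by induction so do the contributions of all [f < e]; the
    remaining terms for [e] are therefore equal. *)
Lemma card_regular_dual e : e \in idemH D ->
  #|regular_orbits bimodJ e| = #|regular_orbits bimodD e|.
Proof.
have [n] := ubnP #|Acorner e|; elim: n e => // n IHn e le_n He.
have := card_corner_dual He; rewrite !card_corner_orbits //.
have Pe : (e \in idemH D) && (e * e == e).
  by rewrite He; apply/eqP; case/idemHP: He.
rewrite (bigD1 e) //= [RHS](bigD1 e) //=.
rewrite (eq_bigr (fun f => #|regular_orbits bimodD f|)); first by move/addIn.
move=> f /andP[/andP[Hf /eqP fe] neq_fe]; apply: IHn => //.
by rewrite -ltnS (leq_trans _ le_n) // ltnS Acorner_lt.
Qed.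

End OrbitCount.

(** * Equality of the numbers of indices *)

Section IndexCount.
Variables (k : finFieldType) (hT : finGroupType) (D : triangular_data k hT).
Variable eps : nontrivial_addchar k.
Local Notation A := (triA D).
Local Notation J := (triJ D).
Local Notation Jd := (triJdual D).
Implicit Types (e : A).

(** One regular element suffices, since [regular_orbit] spreads regularity over its [twin e]
    orbit. *)
Lemma regular_orbJP e (w : {set J}) : e \in idemH D ->
  reflect (exists2 x, regular (bimodJ D) e x
             & w = orbit (twin_action (bimodJ D)) (twin e) x)
          (regular_orbJ e w).
Proof.
move=> He; have [ee _] := idemHP _ He.
apply: (iffP andP) => [[/exists_inP[x Cx /eqP ->] /forall_inP R]|[x Rx ->]].
  rewrite cornerJ // in Cx; rewrite orbJE // in R *; exists x => //.
  by rewrite -regularJE //; apply: R; apply: orbit_refl.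
have Cx : x \in corner (bimodJ D) e by case/andP: Rx.
split; first by apply/exists_inP; exists x; rewrite ?cornerJ // orbJE.
apply/forall_inP => y; rewrite (corner_orbit He Cx) => /setIP[xy Cy].
by rewrite regularJE // (regular_orbit He Rx).
Qed.

Lemma regular_orbJdualP e (w : {set Jd}) : e \in idemH D ->
  reflect (exists2 l, regular (bimodD D) e l
             & w = orbit (twin_action (bimodD D)) (twin e) l)
          (regular_orbJdual e w).
Proof.
move=> He; have [ee _] := idemHP _ He.
apply: (iffP andP) => [[/exists_inP[x Cx /eqP ->] /forall_inP R]|[x Rx ->]].
  rewrite cornerD // in Cx; rewrite orbDE // in R *; exists x => //.
  by rewrite -regularDE //; apply: R; apply: orbit_refl.
have Cx : x \in corner (bimodD D) e by case/andP: Rx.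
split; first by apply/exists_inP; exists x; rewrite ?cornerD // orbDE.
apply/forall_inP => y; rewrite (corner_orbit He Cx) => /setIP[xy Cy].
by rewrite regularDE // (regular_orbit He Rx).
Qed.

Lemma card_regular_orbJ e : e \in idemH D ->
  #|[set w | regular_orbJ e w]| = #|[set w : {set Jd} | regular_orbJdual e w]|.
Proof.
move=> He.
have -> : [set w | regular_orbJ e w]
    = [set orbit (twin_action (bimodJ D)) (twin e) m
        | m in [set m | regular (bimodJ D) e m]].
  apply/setP => w; rewrite inE; apply/(regular_orbJP w He)/imsetP => -[x Rx ->];
    by exists x; rewrite // ?inE // in Rx *.
have -> : [set w : {set Jd} | regular_orbJdual e w]
    = [set orbit (twin_action (bimodD D)) (twin e) m
        | m in [set m | regular (bimodD D) e m]].
  apply/setP => w; rewrite inE; apply/(regular_orbJdualP w He)/imsetP =>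
    -[x Rx ->];
    by exists x; rewrite // ?inE // in Rx *.
rewrite -!card_corner_orbit //; first exact: card_regular_dual.
  by apply/subsetP => m; rewrite inE => /andP[].
by apply/subsetP => m; rewrite inE => /andP[].
Qed.

Lemma Hfix_abelian e : abelian (Hfix e).
Proof. exact: abelianS (subsetT _) (td_abelian D). Qed.

(** Both counts split over [e]: the abelian group [Hfix e] has as many irreducible characters, all
    linear, as elements, and the regular orbits are matched by [card_regular_orbJ]. *)
Lemma card_indexAB : #|{: indexA D}| = #|{: indexB D}|.
Proof.
rewrite [LHS]card_sig [RHS]card_sig.
pose N e := (#|Hfix e| * #|[set w : {set Jd} | regular_orbJdual e w]|)%N.
transitivity (\sum_(e in idemH D) N e).
  rewrite -sum1_card.
  rewrite (eq_bigl (fun a => (tag a \in idemH D) &&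
     (('chi_(tagged a).1 \is a linear_char) &&
       regular_orbJdual (tag a) (tagged a).2))) //.
  rewrite -(sig_big_dep (fun e =>
    e \in idemH D) (fun e (p : Iirr (Hfix e) * {set Jd}) =>
     ('chi_p.1 \is a linear_char) && regular_orbJdual e p.2) (fun _ _ =>
       1%N)) /=.
  apply: eq_bigr => e He; rewrite /N -card_Iirr_abelian ?Hfix_abelian //.
  rewrite -cardsT -cardsX -sum1_card; apply: eq_bigl => -[i w].
  by rewrite in_setX !inE /= (char_abelianP _ (Hfix_abelian e)).
rewrite -sum1_card (eq_bigl (fun b : A * hT * {set J} => (b.1.1 \in idemH D) &&
  ((b.1.2 \in Hfix b.1.1) && regular_orbJ b.1.1 b.2)));
    last by case=> [[e h] w].
rewrite (partition_big (fun b : A * hT * {set J} => b.1.1) (mem (idemH D)));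
  last first.
  by move=> b /andP[].
apply: eq_bigr => e He; rewrite /N -card_regular_orbJ // -cardsX.
pose f (p : hT * {set J}) := (e, p.1, p.2).
have fI : injective f by move=> [h w] [h' w'] [-> ->].
rewrite -(card_imset _ fI) -sum1_card; apply: eq_bigl => -[[e' h] w].
apply/imsetP/andP => [[[h' w']]|[/= /and3P[_ Hh Rw] /eqP e'e]].
  rewrite in_setX /= [w' \in _]inE => /andP[Hh Rw] [-> -> ->].
  by split=> //; apply/and3P.
by subst e'; exists (h, w); rewrite // in_setX Hh inE.
Qed.

End IndexCount.

(** * Superclasses *)

Section Superclasses.
Variables (k : finFieldType) (hT : finGroupType) (D : triangular_data k hT).
Local Notation A := (triA D).
Local Notation J := (triJ D).
Local Notation hA := (@hA k hT D).
Local Notation jA := (@jA k hT D).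
Local Notation pr := (@kHproj k hT D).
Local Notation U := {unit triA D}.
Implicit Types (e f c z : A) (x y : J).

Definition bimodA : bimodule D A := @Bimodule k hT D A
  (fun u m => u * m) (fun m u => m * u)
  (fun u v m => esym (mulrA u v m)) (fun u v m => mulrA m u v)
  (fun u v m => esym (mulrA u m v)) (@mul1r A) (@mulr1 A)
  (fun u v m => mulrBl m u v) (fun u v m => mulrBr m u v)
  (@mulr0 A) (@mul0r A).

Local Notation orbA := (orbit (twin_action bimodA) (twin 1)).
Local Notation orbJ1 := (orbit (twin_action (bimodJ D)) (twin 1)).

Lemma orbAP c c' :
  reflect (exists u v : U, [/\ u \in triG D, v \in triG D,
     pr (toA u) = pr (toA v) & toA u * c' = c * toA v]) (c' \in orbA c).
Proof. by apply: (iffP (twin_orbitP bimodA _ _)). Qed.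

Lemma idemH1 : (1 : A) \in idemH D.
Proof. by apply/idemHP; rewrite mulr1. Qed.

(** By definition [Ract s g - 1 = u (g - 1) v^-1] with [u = ta] and [v = tb]. *)
Lemma superclassE (g : U) :
  superclass g = [set w | toA w - 1 \in orbA (toA g - 1)].
Proof.
have Rc s u v : s \in Gtilde 1 -> companion 1 s (u, v) ->
    Ract s (toA g) = 1 + twin_act bimodA (toA g - 1) (u^-1, v^-1)%g.
  case: s => [[t a] b] Hs C; have W := companion_inv idemH1 Hs C.
  rewrite /Ract -[_ * cinv 1 b * _]mulrA W /twin_act /= invgK mul1r.
  by case: C => /= _; rewrite mul1r => <- _; rewrite mulrA.
apply/setP => w; rewrite [LHS]inE [RHS]inE.
apply/exists_inP/orbitP => [[s Hs /eqP wE]|[[u v] Gg wE]].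
  have [[u v] C] := exists_companion idemH1 Hs.
  exists (u^-1, v^-1)%g; first by rewrite twinV //; case: C.
  by rewrite /toA wE -/(toA g) (Rc s u v) // [RHS]addrC addKr.
have [s Hs C] := exists_triple idemH1 (twinV Gg); exists s => //.
by apply/eqP; rewrite -/(toA g) -/(toA w) (Rc _ _ _ Hs C) !invgK [twin_act _ _
  _]wE addrC subrK.
Qed.

(** From [z ^+ Q = z], the power [q = z ^+ (Q - 1)] is idempotent and [z] is invertible in [q kH]
    with inverse [w = q z ^+ (Q - 2)]; the factor [q] keeps [w] in [q kH] also when [Q = 2]. *)
Lemma kH_fitting z : pr z = z -> exists q w,
  [/\ pr q = q, pr w = w, q * q = q, q * z = z & [/\ z * w = q & q * w = w]].
Proof.
move=> pz; have [Q Q1 HQ] := kHproj_pow D.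
case: Q Q1 HQ => [|[|m]] // _ HQ;
  have {}HQ : z ^+ m.+2 = z by rewrite -{1}pz HQ.
have qq : z ^+ m.+1 * z ^+ m.+1 = z ^+ m.+1.
  by rewrite -exprD addSnnS exprD HQ -exprSr.
exists (z ^+ m.+1), (z ^+ m.+1 * z ^+ m); split=> //.
- by rewrite kHprojX pz.
- by rewrite kHprojM !kHprojX pz.
- by rewrite -exprSr.
- by rewrite mulrA -exprS HQ -exprS mulrA qq.
Qed.

(** [h e = e] says that [h - 1] kills [e], which amounts to [e q = 0] because [h - 1] is invertible
    on [q]. Hence [1 - q] is the largest idempotent fixed by [h]. *)
Lemma Hfix_le h q w e : q * (hA h - 1) = hA h - 1 -> (hA h - 1) * w = q ->
  pr w = w -> e \in idemH D -> (h \in Hfix e) = (e * (1 - q) == e).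
Proof.
move=> qz zw pw He; have [ee pe] := idemHP _ He.
have pz : pr (hA h - 1) = hA h - 1 by rewrite kHprojB.
have pq : pr q = q by rewrite -zw kHprojM pz pw.
have C u : pr u = u -> e * u = u * e by move=> <-; rewrite idemH_comm.
have zwC : (hA h - 1) * w = w * (hA h - 1) by rewrite -pz -pw kHprojC.
rewrite inE; apply/eqP/eqP => [he|e1].
  have ze : (hA h - 1) * e = 0 by rewrite mulrBl mul1r he subrr.
  by rewrite mulrBr mulr1 (C _ pq) -zw zwC -mulrA ze mulr0 subr0.
have eq0 : e * q = 0.
  by have := e1; rewrite mulrBr mulr1 => /eqP; rewrite -subr_eq0 addrAC subrr
    sub0r oppr_eq0 => /eqP.
apply/eqP; rewrite -subr_eq0 -{2}[e]mul1r -mulrBl -(C _ pz) -qz mulrA eq0.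
by rewrite mul0r.
Qed.

(** * Block form with respect to [q] and [1 - q] *)

Section Block.
Variables (q w z : A).
Hypotheses (pq : pr q = q) (pw : pr w = w) (pz : pr z = z).
Hypotheses (qq : q * q = q) (qz : q * z = z) (zw : z * w = q) (qw : q * w = w).
Local Notation p := (1 - q).

Let zq : z * q = z. Proof. by rewrite -pz -pq kHprojC pz pq qz. Qed.
Let wq : w * q = w. Proof. by rewrite -pw -pq kHprojC pw pq qw. Qed.
Let wz : w * z = q. Proof. by rewrite -pw -pz kHprojC pw pz zw. Qed.
Let qp : q * p = 0. Proof. by rewrite mulrBr mulr1 qq subrr. Qed.
Let pp : p * p = p. Proof. by rewrite {1}mulrBl mul1r qp subr0. Qed.
Let zp : z * p = 0. Proof. by rewrite mulrBr mulr1 zq subrr. Qed.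
Let pz0 : p * z = 0. Proof. by rewrite mulrBl mul1r qz subrr. Qed.
Let wp : w * p = 0. Proof. by rewrite mulrBr mulr1 wq subrr. Qed.
Let pw0 : p * w = 0. Proof. by rewrite mulrBl mul1r qw subrr. Qed.
Let prp : pr p = p. Proof. by rewrite kHprojB pq kHproj1. Qed.

Lemma idemH_p : p \in idemH D. Proof. exact/idemHP. Qed.

(* The block q c q is brought to z, and the two off-diagonal blocks are then
   eliminated (Schur complement). *)
Lemma superclass_block c : pr c = z ->
  exists2 y, y \in corner (bimodJ D) p & z + jA y \in orbA c.
Proof.
(* Here [n] lies in [J] and [(1 + n) z = q c q], so dividing by the unit [1 + n] on the left turns
   the [q] block into [z]. *)
move=> pc; pose n := q * c * w - q.
have prn : pr (1 + n) = hA 1%g.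
  by rewrite kHprojD kHprojB !kHprojM pq pc pw qz zw subrr addr0.
have [u1 Gu1 u1E] := triG_unit prn.
have qn : q * n = n by rewrite mulrBr !mulrA qq.
have nq : n * q = n by rewrite /n mulrBl -!mulrA wq qq.
have qu1 : q * toA u1 = toA u1 * q.
  by rewrite u1E mulrDl mulrDr mulr1 mul1r qn nq.
pose c1 := toA u1^-1%g * c.
have qc1 : q * c1 * q = z.
  have nz : (1 + n) * z = q * c * q.
    by rewrite mulrDl mul1r mulrBl -!mulrA wz qz addrC subrK.
  by rewrite mulrA toAVC // -!mulrA [q * (c * q)]mulrA -nz -u1E mulrA toAVl
    mul1r.
have pu1 : pr (toA u1^-1%g) = 1.
  by have := congr1 pr (toAVl u1); rewrite kHprojM u1E prn hA1 mulr1.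
have pc1 : pr c1 = z by rewrite kHprojM pu1 mul1r.
have c1def : c1 = toA u1^-1%g * c by []; clearbody c1.
pose al := p * c1 * p; pose be := p * c1 * q; pose ga := q * c1 * p.
have c1E : c1 = z + al + be + ga.
  have split4 (a b : A) : a + b = 1 ->
      c1 = a * c1 * a + b * c1 * b + b * c1 * a + a * c1 * b.
    move=> ab; rewrite -[LHS]mul1r -[LHS]mulr1 -ab mulrDr 3!mulrDl.
    by rewrite [X in _ + X = _]addrC addrACA addrA.
  by rewrite {1}(split4 q p) ?qc1 // addrC subrK.
have [w_al w_be] : w * al = 0 /\ w * be = 0 by rewrite !mulrA wp !mul0r.
have [al_w ga_w] : al * w = 0 /\ ga * w = 0 by rewrite -!mulrA pw0 !mulr0.
have [q_ga be_q] : q * ga = ga /\ be * q = be.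
  by split; [rewrite /ga !mulrA qq | rewrite /be -!mulrA qq].
have prbe : pr be = 0 by rewrite !kHprojM pc1 prp pz0 mul0r.
have prga : pr ga = 0 by rewrite !kHprojM pc1 prp -mulrA zp mulr0.
have pral : pr al = 0 by rewrite !kHprojM pc1 prp -mulrA zp mulr0.
have [p_al al_p] : p * al = al /\ al * p = al.
  by split; [rewrite /al !mulrA pp | rewrite /al -!mulrA pp].
have [p_be ga_p] : p * be = be /\ ga * p = ga.
  by split; [rewrite /be !mulrA pp | rewrite /ga -!mulrA pp].
clearbody al be ga.
(* Left multiplication by [1 - be w] clears the block [be], right multiplication by [1 - w ga]
   clears [ga], and the Schur complement [t] remains in the block of [p]. *)
have prb1 : pr (1 - be * w) = hA 1%g by rewrite kHprojB kHprojM prbe mul0r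
  subr0.
have prb2 : pr (1 - w * ga) = hA 1%g by rewrite kHprojB kHprojM prga mulr0
  subr0.
have [b1 Gb1 b1E] := triG_unit prb1; have [b2 Gb2 b2E] := triG_unit prb2.
pose t := al - be * w * ga.
have prt : pr t = 0 by rewrite kHprojB !kHprojM pral prbe !mul0r subrr.
have b1c1 : toA b1 * c1 = z + al + ga - be * w * ga.
  have E : be * w * c1 = be + be * w * ga.
    by rewrite c1E !mulrDr -!mulrA wz be_q w_al w_be !mulr0 !addr0.
  rewrite b1E mulrBl mul1r E c1E opprD addrA; congr (_ - _).
  by rewrite addrAC addrK.
have b1c1b2 : toA b1 * c1 * toA b2 = z + t.
  have E : (z + al + ga - be * w * ga) * (w * ga) = ga.
    rewrite mulrBl !mulrDl [z * _]mulrA zw q_ga [al * _]mulrA al_w mul0r addr0.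
    by rewrite [ga * _]mulrA ga_w -!mulrA [ga * (w * ga)]mulrA ga_w !(mul0r,
      mulr0) addr0 subr0.
  by rewrite b1c1 b2E mulrBr mulr1 E addrAC addrK -addrA.
have jt : jA (pJ t) = t by rewrite [RHS]kHproj_split prt add0r.
exists (pJ t).
  apply/cornerP; split; apply: jA_inj; rewrite /= ?jA_lmulJ ?jA_rmulJ jt.
    by rewrite mulrBr p_al !mulrA p_be.
  by rewrite mulrBl al_p -[_ * ga * p]mulrA ga_p.
rewrite jt; apply/orbAP; exists (b1 * u1^-1)^-1%g, b2; split=> //.
- by rewrite groupV groupM // groupV.
- have : pr (toA (b1 * u1^-1)%g) =
  1 by rewrite toAM kHprojM b1E prb1 hA1 pu1 mulr1.
  move=> E; have := congr1 pr (toAVl (b1 * u1^-1)%g).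
  by rewrite kHprojM E mulr1 b2E prb2 => ->.
have gE : toA (b1 * u1^-1)%g * c = toA b1 * c1 by rewrite toAM c1def mulrA.
move: (b1 * u1^-1)%g gE => g gE.
by rewrite -b1c1b2 -gE !mulrA toAVl mul1r.
Qed.

(** Compression by [p] kills [z] and leaves the orbit equation for [y] and [y']. Conversely, the
    cuts of [u] and [v] act on [q] through their common component in H, which commutes with [z]. *)
Lemma block_orbit y y' : y \in corner (bimodJ D) p ->
  y' \in corner (bimodJ D) p ->
  (z + jA y' \in orbA (z + jA y)) = (y' \in orbJ1 y).
Proof.
move=> Cy Cy'; have [/= py yp] := cornerP _ _ _ Cy.
have [/= py' yp'] := cornerP _ _ _ Cy'.
have [jpy jyp] : p * jA y = jA y /\ jA y * p = jA y.
  by rewrite -jA_lmulJ py -jA_rmulJ yp.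
have [jpy' jyp'] : p * jA y' = jA y' /\ jA y' * p = jA y'.
  by rewrite -jA_lmulJ py' -jA_rmulJ yp'.
apply/orbAP/idP => [[u [v [Gu Gv uv E]]]|].
  have : y' \in orbit (twin_action (bimodJ D)) (twin p) y.
    apply: (corner_orbitI idemH_p Cy Cy' Gu Gv uv); apply: jA_inj => /=.
    have sand (P a b : A) : P * (a + b) * P = P * a * P + P * b * P.
      by rewrite mulrDr mulrDl.
    have := congr1 (fun m => p * m * p) E.
    rewrite [toA u * _]mulrDr [_ * toA v]mulrDl !sand.
    rewrite -[p * (_ * z) * p]mulrA -[toA u * z * p]mulrA zp.
    rewrite [p * (z * _)]mulrA pz0 !(mulr0, mul0r, add0r).
    rewrite -[p * (_ * jA y') * p]mulrA -[_ * jA y' * p]mulrA jyp'.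
    rewrite [p * (jA y * _)]mulrA jpy => E'.
    by rewrite jA_lmulJ jA_lmulJ jA_rmulJ jA_rmulJ.
  by rewrite (corner_orbit idemH_p Cy) => /setIP[].
move=> O; have : y' \in orbit (twin_action (bimodJ D)) (twin p) y.
  by rewrite (corner_orbit idemH_p Cy) in_setI O.
case/orbitP=> -[u v] Guv /esym/eqP.
have [Gu Gv uv pu pv] := twinP _ _ _ Guv.
rewrite -[twin_action _ _ _]/(twin_act _ _ _) twin_actP => /eqP/= E.
have [u' [Gu' pu' pu1 u1p [_ uq]]] := cut_unit idemH_p Gu.
have [v' [Gv' pv' pv1 v1p [qv _]]] := cut_unit idemH_p Gv.
have qE : 1 - p = q by rewrite opprB addrC subrK.
rewrite qE in uq qv.
have jE : toA u * jA y' = jA y * toA v by rewrite -jA_lmulJ E jA_rmulJ.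
exists u', v'; split; rewrite ?pu' ?pv' //.
rewrite mulrDr mulrDl; congr (_ + _).
  have -> : toA u' * z = pr (toA u) * z by rewrite -{1}qz mulrA uq -mulrA qz.
  by rewrite -{2}zq -mulrA qv mulrA -uv -{2}pz kHprojC pz -mulrA zq.
rewrite -jpy' -jyp [toA u' * _]mulrA u1p -[jA y * p * _]mulrA pv1.
by rewrite -!mulrA jpy' jE !mulrA jpy jyp -jE -mulrA jyp'.
Qed.

End Block.
Lemma superclass_refl (g : U) : g \in superclass g.
Proof. by rewrite superclassE inE orb_refl. Qed.

Lemma superclass_eq (g w : U) :
  w \in superclass g -> superclass w = superclass g.
Proof.
rewrite !superclassE inE => gw; apply/setP => v; rewrite !inE.
by apply/idP/idP => [/(orb_trans gw)|]; last by apply: orb_trans;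
  rewrite orb_sym.
Qed.

(** [u] and [v] have the same projection, a unit of the commutative ring kH, which cancels. *)
Lemma orbA_proj c c' : c' \in orbA c -> pr c' = pr c.
Proof.
case/orbAP=> u [v [Gu _ uv E]].
have := congr1 pr E; rewrite !kHprojM -uv [pr c * _]kHprojC =>
  /(congr1 (GRing.mul (pr (toA u^-1%g)))).
by rewrite !mulrA -kHprojM toAVl kHproj1 !mul1r.
Qed.

Lemma toA_tunitB h x : toA (tunit h x) - 1 = (hA h - 1) + jA x.
Proof. by rewrite toA_tunit addrAC. Qed.

Lemma proj_tunitB h x : pr (toA (tunit h x) - 1) = hA h - 1.
Proof. by rewrite toA_tunitB kHprojD kHproj_jA addr0 kHprojB. Qed.

Lemma superclass_triG (g w : U) :
  g \in triG D -> w \in superclass g -> w \in triG D.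
Proof.
case/imset2P=> h x _ _ ->; rewrite superclassE inE => /orbA_proj.
rewrite proj_tunitB kHprojB kHproj1 => /addIr wh.
by have [v Gv /toA_inj <-] := triG_unit wh.
Qed.

Lemma superclass_hpart h h' x x' :
  tunit h' x' \in superclass (tunit h x) -> h' = h.
Proof.
rewrite superclassE inE => /orbA_proj; rewrite !proj_tunitB => /addIr.
exact: hA_inj.
Qed.

(** [p] is the idempotent of kH on which [h - 1] vanishes while it is invertible on [1 - p].
    Superclasses with component [h] thereby become orbits on the corner of [p]. *)
Lemma fitting_unipotent h : exists p, [/\ p \in idemH D,
  forall e, e \in idemH D -> (h \in Hfix e) = (e * p == e),
  forall x, exists2 y, y \in corner (bimodJ D) p
                     & tunit h y \in superclass (tunit h x)
  & forall y y', y \in corner (bimodJ D) p -> y' \in corner (bimodJ D) p ->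
    (tunit h y' \in superclass (tunit h y)) = (y' \in orbJ1 y)].
Proof.
have pz : pr (hA h - 1) = hA h - 1 by rewrite kHprojB.
have [q [w [pq pw qq qz [zw qw]]]] := kH_fitting pz.
exists (1 - q); split.
- exact: idemH_p.
- by move=> e; apply: Hfix_le zw pw.
- move=> x; have [y Cy zy] := superclass_block pq pw pz qq qz zw qw
  (proj_tunitB h x).
  by exists y => //; rewrite superclassE inE toA_tunitB.
- move=> y y' Cy Cy'; rewrite superclassE inE !toA_tunitB.
  exact: block_orbit pq pz qq qz _ _ Cy Cy'.
Qed.

(** Both [e] and [e'] lie below the largest idempotent fixed by [h], so the comparison takes place
    in its corner. *)
Lemma superclass_corner e e' h y y' : e \in idemH D -> e' \in idemH D ->
  h \in Hfix e -> h \in Hfix e' -> y \in corner (bimodJ D) e ->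
  y' \in corner (bimodJ D) e' ->
  (tunit h y' \in superclass (tunit h y)) = (y' \in orbJ1 y).
Proof.
move=> He He'; have [p [Hp fixP _ orbP']] := fitting_unipotent h.
rewrite !fixP // => /eqP ep /eqP e'p Cy Cy'; apply: orbP'.
  by apply: subsetP Cy; apply: corner_sub => //; rewrite idemHK.
by apply: subsetP Cy'; apply: corner_sub => //; rewrite idemHK.
Qed.

Lemma KclassE (b : indexB D) : exists e h y,
  [/\ [/\ e \in idemH D, h \in Hfix e & regular (bimodJ D) e y],
      val b = (e, h, orbit (twin_action (bimodJ D)) (twin e) y)
    & Kclass b = superclass (tunit h y)].
Proof.
rewrite /Kclass; move: (xchoose _) (xchooseP (indexB_inh b)) => y.
case: b => [[[e h] w] Pb] /= wy;
  case/and3P: (Pb) => He Hh /(regular_orbJP _ He)[x Rx wx].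
have Cx : x \in corner (bimodJ D) e by case/andP: Rx.
have /setIP[xy Cy] : y \in orbJ1 x :&: corner (bimodJ D) e.
  by rewrite -corner_orbit // -wx.
exists e, h, y; split=> //; first by split; rewrite // (regular_orbit He Rx).
by rewrite wx; congr (_, _); apply/orbit_eqP; rewrite orbit_sym -wx.
Qed.

Lemma Kclass_cover (g : U) : g \in triG D -> exists b : indexB D,
  g \in Kclass b.
Proof.
case/imset2P=> h x _ _ ->; have [p [Hp fixP block orbP']] :=
  fitting_unipotent h.
have [y Cy xy] := block x.
have [f [y' [Hf fp Ry' yy']]] := exists_regular Hp Cy.
have Hh : h \in Hfix f by rewrite fixP // fp.
have Pb : indexB_pred (f, h, orbit (twin_action (bimodJ D)) (twin f) y').
  by apply/and3P; split=> //; apply/(regular_orbJP _ Hf); exists y'.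
exists (Sub _ Pb); have [e [h' [y'' [[_ Hh' Ry''] [<- <- E] ->]]]] :=
  KclassE (Sub _ Pb).
have Cy' : y' \in corner (bimodJ D) f by case/andP: Ry'.
(* The representative [y''] used by [Kclass] need not be [y'], but lies in the same orbit. *)
have /setIP[y'y'' Cy''] : y'' \in orbJ1 y' :&: corner (bimodJ D) f.
  by rewrite -corner_orbit // E orbit_refl.
have sub : corner (bimodJ D) f \subset corner (bimodJ D) p.
  by apply: corner_sub => //; rewrite idemHK.
suff: tunit h y'' \in superclass (tunit h x).
  by move/superclass_eq->; apply: superclass_refl.
rewrite -(superclass_eq xy) orbP' // ?(subsetP sub) //.
exact: orb_trans yy' y'y''.
Qed.

(** A common element gives equal components in H and puts [y] and [y'] in one orbit; [regular_uniq]
    then yields [e = e'], and [corner_orbit] yields the equality of the orbits in the corner. *)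
Lemma Kclass_inj (b b' : indexB D) (g : U) :
  g \in Kclass b -> g \in Kclass b' -> b = b'.
Proof.
have [e [h [y [[He Hh Ry] bE ->]]]] := KclassE b.
have [e' [h' [y' [[He' Hh' Ry'] bE' ->]]]] := KclassE b'.
move=> /superclass_eq gE /superclass_eq; rewrite gE => E.
have: tunit h' y' \in superclass (tunit h y) by rewrite E superclass_refl.
move=> /[dup]/superclass_hpart hh'; rewrite {}hh' in Hh' bE' *.
have Cy : y \in corner (bimodJ D) e by case/andP: Ry.
have Cy' : y' \in corner (bimodJ D) e' by case/andP: Ry'.
rewrite (superclass_corner He He') // => yy'.
have ee' := regular_uniq He He' Ry Ry' yy'.
apply: val_inj; rewrite bE bE' -{}ee' in Cy' *; congr (_, _).
by apply/orbit_eqP; rewrite corner_orbit // in_setI Cy orb_sym yy'.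
Qed.

Lemma Kclass_sub (b : indexB D) : Kclass b \subset triG D.
Proof.
have [e [h [y [_ _ ->]]]] := KclassE b.
by apply/subsetP => w; apply: superclass_triG; apply: imset2_f.
Qed.

(** The superclass of 1 corresponds to the orbit of 0, which is a single point. *)
Lemma Kclass_one : exists b : indexB D, Kclass b = [set 1%g].
Proof.
have [b Kb] := Kclass_cover (group1 (triG_group D)).
exists b; have [e [h [y [_ _ E]]]] := KclassE b.
rewrite E -(superclass_eq (w := 1%g)) -?E // superclassE.
apply/setP => w; rewrite !inE toA1 subrr;
  apply/orbAP/eqP => [[u [v [_ _ _]]]|->].
  rewrite mul0r => /(congr1 (GRing.mul (toA u^-1%g))).
  rewrite mulrA toAVl mulr0 mul1r => /eqP; rewrite subr_eq0 => /eqP w1.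
  exact: toA_inj.
by exists 1%g, 1%g; rewrite group1 toA1 subrr mulr0 mul0r.
Qed.

Lemma partition_Kclass :
  partition [set Kclass b | b : indexB D] (triG D) /\ injective (@Kclass _ _ D).
Proof.
have inh (b : indexB D) : exists g, g \in Kclass b.
  by have [e [h [y [_ _ ->]]]] := KclassE b; exists (tunit h y);
    apply: superclass_refl.
split=> [|b b' E]; last first.
  by have [g Kg] := inh b; apply: (Kclass_inj Kg); rewrite -E.
apply/and3P; split.
- rewrite eqEsubset; apply/andP; split.
    by apply/bigcupsP => _ /imsetP[b _ ->]; apply: Kclass_sub.
  apply/subsetP => g /Kclass_cover[b Kb].
  by apply/bigcupP; exists (Kclass b) => //; apply: imset_f.
- apply/trivIsetP => _ _ /imsetP[b _ ->] /imsetP[b' _ ->] neq_bb'.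
  rewrite -setI_eq0; apply: contraNT neq_bb' => /set0Pn[g /setIP[Kb Kb']].
  by rewrite (Kclass_inj Kb Kb').
- by apply/negP => /imsetP[b _ E]; have [g] := inh b; rewrite -E inE.
Qed.

End Superclasses.

(** * Supercharacters *)

Section LinearInduced.
Variables (gT : finGroupType).
Implicit Types (G H K : {group gT}).

(** Such a [phi] is afforded by the 1 by 1 scalar matrices [phi x]. *)
Lemma lin_char_morph G (phi : 'CF(G)) : phi 1%g = 1 ->
  {in G &, {morph phi : x y / (x * y)%g >-> x * y}} -> phi \is a linear_char.
Proof.
move=> phi1 phiM; pose r x : 'M[algC]_1 := (phi x)%:M.
have rP : mx_repr G r.
  by split=> [|x y Gx Gy]; rewrite /r ?phi1 // phiM // scalar_mxM.
have -> : phi = cfRepr (MxRepresentation rP).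
  apply/cfun_inP => x Gx; rewrite cfunE Gx /= /r mxtrace_scalar //.
by rewrite qualifE /= cfRepr_char cfRepr1 eqxx.
Qed.

(** Frobenius reciprocity and the formula for induced characters give, up to a scalar, the sum of
    all [S s]; some [S s] is therefore nonzero. Translating its summation variable by [g0]
    multiplies it by [phi g0] times the conjugate of [psi (g0 ^ s)], so this factor is 1. *)
Lemma cfdot_Ind_lin_neq0 G H K (phi : 'CF(H)) (psi : 'CF(K)) :
  H \subset G -> K \subset G -> phi \is a linear_char ->
    psi \is a linear_char ->
  '['Ind[G] phi, 'Ind[G] psi] != 0 ->
  exists2 s, s \in G & forall g, g \in H -> (g ^ s)%g \in K -> phi g =
    psi (g ^ s)%g.
Proof.
move=> sHG sKG Lphi Lpsi; rewrite -Frobenius_reciprocity cfdotE => nz.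
pose S s := \sum_(g in H) phi g * (psi (g ^ s)%g)^*.
have {nz} : \sum_(s in G) S s != 0.
  apply: contraNneq nz => S0.
  rewrite (eq_bigr (fun g => #|K|%:R^-1 * \sum_(s in G) phi g * (psi (g ^
    s)%g)^*)).
    by rewrite -mulr_sumr exchange_big S0 !mulr0.
  move=> g Hg; rewrite cfResE // cfIndE //
    rmorphM fmorphV rmorph_nat rmorph_sum.
  by rewrite mulrCA mulr_sumr.
case: (pickP [pred s | (s \in G) && (S s != 0)]) => [s /andP[Gs nzS] _|S0];
  last first.
  by rewrite big1 ?eqxx // => s Gs; have := S0 s; rewrite /= Gs => /negbFE/eqP.
exists s => // g0 Hg0 Kg0.
have SE : S s = phi g0 * (psi (g0 ^ s)%g)^* * S s.
  rewrite {1}/S (reindex_inj (mulgI g0)) mulr_sumr /=.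
  apply: eq_big => [g|g]; rewrite groupMl // => Hg.
  rewrite (lin_charM Lphi) // conjMg.
  have [Kg|nKg] := boolP ((g ^ s)%g \in K).
    by rewrite (lin_charM Lpsi) // rmorphM /= mulrACA.
  have nKg0 : (g0 ^ s * g ^ s)%g \notin K by rewrite (groupMl _ Kg0).
  by rewrite [psi (g ^ s)%g]cfun0 // [psi _]cfun0 // !Num.Theory.conjC0 !mulr0.
have : phi g0 * (psi (g0 ^ s)%g)^* = 1.
  by apply: (mulIf nzS); rewrite -SE mul1r.
move/(congr1 (fun c => c * psi (g0 ^ s)%g)).
by rewrite mul1r -mulrA [_^* * _]mulrC -Num.Theory.normCK normC_lin_char //
  expr1n mulr1.
Qed.

End LinearInduced.

(** * Values of the supercharacters and coincidences between the inducing characters *)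

Section Supercharacters.
Variables (k : finFieldType) (hT : finGroupType) (D : triangular_data k hT).
Variable eps : nontrivial_addchar k.
Local Notation A := (triA D).
Local Notation J := (triJ D).
Local Notation Jd := (triJdual D).
Local Notation hA := (@hA k hT D).
Local Notation jA := (@jA k hT D).
Local Notation pr := (@kHproj k hT D).
Local Notation U := {unit triA D}.
Implicit Types (x y : J) (l : Jd) (p : dual_point D).

Lemma JrightP l x : reflect (forall y, l (mulJ x y) = 0) (x \in Jright l).
Proof. by rewrite inE; apply: (iffP forallP) => H y; apply/eqP. Qed.

Lemma dualZ l c x : l (c *: x) = c * l x :> k.
Proof. by rewrite linearZ. Qed.

Lemma dualB l x y : l (x - y) = l x - l y.
Proof. by rewrite linearB. Qed.

Lemma jA_mulJ x y : jA (mulJ x y) = jA x * jA y. Proof. by rewrite jAM. Qed.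

Lemma Glam_sub p : Glam p \subset triG D.
Proof. by apply/subsetP => _ /imset2P[h x _ _ ->]; apply: imset2_f. Qed.

Lemma hpart_proj (u : U) h : u \in triG D -> pr (toA u) = hA h -> exists x, u =
  tunit h x.
Proof.
case/imset2P=> g x _ _ ->; rewrite toA_tunit kHprojD kHproj_jA addr0.
by move/hA_inj <-; exists x.
Qed.

Lemma tunit_inj h h' x x' : tunit h x = tunit h' x' -> h = h' /\ x = x' :> J.
Proof.
move=> E; have hh' := congr1 (@hpart _ _ D) E;
  have xx' := congr1 (fun u : U => pJ (val u)) E.
by rewrite !hpart_tunit in hh'; rewrite !pJ_tunit in xx'.
Qed.

Lemma Glam_tunit p h x :
  (tunit h x \in Glam p) = (h \in Hfix (dp_idem p)) &&
    (x \in Jright (dp_form p)).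
Proof.
apply/imset2P/andP => [[h' x' Hh' Jx' /tunit_inj[-> ->]]|[Hh Jx]] //.
by exists h x.
Qed.

(** In the product the component in [J] is [h1 x2 + x1 h2 + x1 x2]; the form is invariant under
    [Hfix e] on both sides and vanishes on [x1 J]. *)
Lemma xi_lin p theta : theta \is a linear_char ->
  @xi _ _ D eps p theta \is a linear_char.
Proof.
move=> Lt; case: p theta Lt => e l He le theta Lt; apply: lin_char_morph.
  rewrite -tunit1 xiE ?group1 //;
    first by rewrite lin_char1 // mul1r linear0 addchar0.
  by apply/JrightP => y; rewrite mul0J linear0.
move=> _ _ /imset2P[h1 x1 Hh1 Jx1 ->] /imset2P[h2 x2 Hh2 Jx2 ->].
have Gp : (tunit h1 x1 * tunit h2 x2)%g \in Glam (DualPoint He le).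
  by rewrite groupM // Glam_tunit ?Hh1 ?Hh2.
rewrite tunitM in Gp *; move: Gp; rewrite Glam_tunit => /andP[Hh Jx].
rewrite !xiE //= lin_charM // Defs.formD Defs.formD (dual_lacth _ He le Hh1).
rewrite (dual_racth _ He le Hh2) (Jright_mul _ Jx1) addr0 addrC addcharD.
by rewrite mulrACA.
Qed.

Lemma chi_point_char p theta : theta \is a linear_char ->
  @chi_point _ _ D eps p theta \is a character /\ chi_point eps theta !=
    0 :> 'CF(triG D).
Proof.
move=> Lt; have Lx := xi_lin Lt; split; first by rewrite cfInd_char ?lin_charW.
apply/eqP => /(congr1 (fun phi : 'CF(triG D) => phi 1%g)).
rewrite cfInd1 ?Glam_sub // [RHS]cfunE lin_char1 // mulr1 => /eqP.
by rewrite Num.Theory.pnatr_eq0 eqn0Ngt indexg_gt0.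
Qed.

(** For [g = h + x] in [Glam p] and [c = 1 + j], the new component [h j - j + x + x j] is again in
    [Jright] and has the same value under the form, which is left invariant under [h] and zero on
    [x J]. Using [c^-1], the two elements are in [Glam p] together or not at all. *)
Lemma xi_mulr p theta (g g' c : U) : theta \is a linear_char ->
  g \in triG D -> g' \in triG D -> c \in triG D -> pr (toA c) = 1 ->
  toA g' - 1 = (toA g - 1) * toA c ->
  @xi _ _ D eps p theta g' = xi eps theta g.
Proof.
move=> Lt.
have key g1 g2 c1 : g1 \in Glam p -> g2 \in triG D -> c1 \in triG D ->
    pr (toA c1) = 1 -> toA g2 - 1 = (toA g1 - 1) * toA c1 ->
    g2 \in Glam p /\ @xi _ _ D eps p theta g2 = xi eps theta g1.
  case: p theta Lt => e l He le theta Lt.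
  move=> /imset2P[h x Hh Jx ->] Gg2 Gc1 pc1.
  have [j -> {c1 Gc1 pc1}] := hpart_proj Gc1 pc1.
  case/imset2P: Gg2 => h2 x2 _ _ -> E.
  have hh2 : h2 = h.
    have := congr1 pr E; rewrite kHprojM !proj_tunitB toA_tunit kHprojD
      kHproj_jA addr0 mulr1.
    by move/addIr/hA_inj.
  subst h2; have x2E : x2 = lacth h j - j + x + mulJ x j.
    apply: jA_inj; rewrite 2!jAD jAB -hA_jA jA_mulJ.
    have := E; rewrite !toA_tunitB toA_tunit mulrDr mulr1 [X in _ =
      _ + X]mulrDl mulrBl mul1r.
    move=> E1; apply: (addrI (hA h - 1)); rewrite E1 -addrA; congr (_ + _).
    by rewrite addrA [jA x + _]addrC.
  have Jx2 : x2 \in Jright l.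
    apply/JrightP => y; rewrite x2E !mulJDl.
    have -> : mulJ (- j) y = - mulJ j y.
      by apply/eqP; rewrite -addr_eq0 -mulJDl addNr mul0J.
    rewrite -mulJA -lacth_mul Defs.formD Defs.formD Defs.formD linearN
      (dual_lacth _ He le Hh) subrr.
    by rewrite !(Jright_mul _ Jx) !addr0.
  rewrite Glam_tunit [dp_idem _]/= Hh Jx2; split=> //; rewrite !xiE //=;
    congr (_ * eps _).
  rewrite x2E Defs.formD Defs.formD Defs.formD linearN (dual_lacth _ He le Hh)
    subrr add0r.
  by rewrite (Jright_mul _ Jx) addr0.
move=> Gg Gg' Gc pc E; have [Pg|Pg] := boolP (g \in Glam p).
  by have [_ ->] := key _ _ _ Pg Gg' Gc pc E.
have [Pg'|Pg'] := boolP (g' \in Glam p); last by rewrite !cfun0.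
have pcV : pr (toA c^-1%g) = 1.
  by have := congr1 pr (toAVl c); rewrite kHprojM pc mulr1.
have EV : toA g - 1 = (toA g' - 1) * toA c^-1%g by rewrite E -mulrA toAV mulr1.
by case/negP: Pg; have [] := key _ _ _ Pg' Gg (groupVr Gc) pcV EV.
Qed.

(** From [u (w - 1) = (g - 1) v] one gets [u w u^-1 - 1 = (g - 1) v u^-1] with [v u^-1] in [1 + J];
    then [xi_mulr] applies to each term of the induction formula. *)
Lemma chi_point_superclass p theta (g w : U) : theta \is a linear_char ->
  g \in triG D -> w \in superclass g ->
  @chi_point _ _ D eps p theta w = chi_point eps theta g.
Proof.
move=> Lt Gg /[dup] gw; rewrite superclassE inE => /orbAP[u [v [Gu Gv uv E]]].
have Gw := superclass_triG Gg gw.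
rewrite -(cfunJ _ w (groupVr Gu)) !cfIndE ?Glam_sub //; congr (_ * _).
apply: eq_bigr => s Gs.
apply: (@xi_mulr _ _ _ _ ((v * u^-1) ^ s)%g) => //;
  rewrite ?groupJ ?groupM ?groupV //.
  have pJ1 (c : U) : pr (toA c) = 1 -> pr (toA (c ^ s)%g) = 1.
    move=> pc; rewrite conjgE !toAM !kHprojM pc mul1r.
    by rewrite -kHprojM toAVl.
  by apply: pJ1; rewrite toAM kHprojM -uv -kHprojM toAV.
have JB (c r : U) : toA (c ^ r)%g - 1 = toA r^-1%g * (toA c - 1) * toA r.
  by rewrite conjgE !toAM mulrBr mulrBl mulr1 toAVl mulrA.
have -> : toA ((v * u^-1) ^ s)%g = toA s^-1%g * (toA v * toA u^-1%g) * toA s.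
  by rewrite conjgE !toAM mulrA.
rewrite !JB invgK E -!mulrA; congr (_ * (_ * _)).
by rewrite [toA s * _]mulrA toAV mul1r.
Qed.

(** If no pair [q] makes [phi q] vanish, the sum of [eps (phi q x)] over all [q] and [x] is zero, as
    seen by summing over [x] first. Summing over [q] first gives the square of [#|J|] times the
    number of [x] in both right annihilators, and 0 is one of these. *)
Lemma double_perp (l1 l2 m : Jd) :
  (forall x, x \in Jright l1 -> x \in Jright l2 -> eps (m x) = 1) ->
  exists y1 y2, forall x, m x = l1 (mulJ x y1) + l2 (mulJ x y2).
Proof.
move=> H.
pose phi (q : J * J) x := l1 (mulJ x q.1) + l2 (mulJ x q.2) - m x.
have [q phiq|no] := pickP (fun q => [forall x, phi q x == 0]).
  exists q.1, q.2 => x; apply/esym/eqP; rewrite -subr_eq0.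
  exact: (forallP phiq x).
pose S : algC := \sum_(q : J * J) \sum_(x : J) eps (phi q x).
have S0 : S = 0.
  apply: big1 => q _; rewrite (sum_addchar eps).
  - by rewrite no.
  - have rearr (a b c d e f : k) : a + b + (c + d) - (e + f) =
    a + c - e + (b + d - f).
      by rewrite opprD [a + b + _]addrACA [LHS]addrACA.
    by move=> x x'; rewrite /phi !mulJDl !Defs.formD; apply: rearr.
  move=> c x; exists (c *: x); rewrite /phi !mulJZl.
  by rewrite !dualZ mulrBr mulrDr.
have sumJ l x : \sum_(y : J) eps (l (mulJ x y))
    = if x \in Jright l then #|J|%:R else 0.
  rewrite (sum_addchar eps) ?inE // => [y z|c y];
    first by rewrite mulJDr linearD.
  by exists (c *: y); rewrite mulJZr dualZ.
pose W := [set x in Jright l1 | x \in Jright l2].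
suff SE : S = (#|W| * (#|J| * #|J|))%:R.
  have J0 : (0 < #|J|)%N by apply/card_gt0P; exists 0.
  have W0 : (0 < #|W|)%N.
    apply/card_gt0P; exists 0; rewrite !inE.
    by apply/andP; split; apply/forallP => y; rewrite mul0J linear0.
  move: S0; rewrite SE => /eqP; rewrite Num.Theory.pnatr_eq0 eqn0Ngt.
  by rewrite !muln_gt0 W0 J0.
rewrite /S exchange_big -[#|W|]sum1_card big_distrl natr_sum /= [RHS]big_mkcond.
apply: eq_bigr => x _ /=.
have -> : \sum_(q : J * J) eps (phi q x) = eps (- m x) *
    ((\sum_(y : J) eps (l1 (mulJ x y))) * \sum_(y : J) eps (l2 (mulJ x y))).
  rewrite big_distrlr /= pair_big /= mulr_sumr; apply: eq_bigr => q _.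
  by rewrite /phi !addcharD mulrC.
rewrite !sumJ [x \in W]inE; case: ifP => [x1|_] /=; last by rewrite mul0r mulr0.
case: ifP => [x2|_]; last by rewrite !mulr0.
have -> : eps (- m x) = 1.
  by have := addcharD eps (- m x) (m x); rewrite addNr addchar0 (H x) // mulr1.
by rewrite mul1r mul1n natrM.
Qed.

(** * Consequences of an agreement of [xi] with a conjugate of another *)

Section Overlap.
Variables (p p' : dual_point D).
Variables (theta : 'CF(Hfix (dp_idem p))) (theta' : 'CF(Hfix (dp_idem p'))).
Hypotheses (Lt : theta \is a linear_char) (Lt' : theta' \is a linear_char).
Variable s : U.
Hypothesis Gs : s \in triG D.
Hypothesis agree : forall g, g \in Glam p -> (g ^ s)%g \in Glam p' ->
  xi eps theta g = xi eps theta' (g ^ s)%g.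

Local Notation l := (dp_form p).
Local Notation l' := (dp_form p').
(** The conjugate [s l' s^-1], whose value at [x] is [l' (s^-1 x s)]. *)
Let l2 := lmulD (toA s) (rmulD l' (toA s^-1%g)).

Let l2E x : l2 x = l' (lmulJ (toA s^-1%g) (rmulJ x (toA s))).
Proof. by rewrite lmulDE rmulDE. Qed.

(** [double_perp] writes [l - l2] as [y1 l + y2 l2], that is [(1 - y1) l = (1 + y2) l2] with both
    factors invertible in [1 + J]. *)
Lemma twisted_form : exists b : U, [/\ b \in triG D, pr (toA b) = 1
  & lmulD (toA b) l = l2].
Proof.
have [x Jx Jx2|y1 [y2 E]] := @double_perp l l2 (l - l2).
  (* For [x] annihilated by both forms, [1 + x] lies in [Glam p] and its conjugate in [Glam p'], so
     the agreement reads [eps (l x) = eps (l2 x)]. *)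
  have gsE : (tunit 1 x ^ s)%g = tunit 1 (lmulJ (toA s^-1%g) (rmulJ x (toA s))).
    apply: toA_inj; rewrite conjgE !toAM !toA_tunit jA_lmulJ jA_rmulJ hA1.
    by rewrite mulrDl mulrDr mul1r toAVl.
  have Pg : tunit 1 x \in Glam p by rewrite Glam_tunit group1.
  have Jx' : lmulJ (toA s^-1%g) (rmulJ x (toA s)) \in Jright l'.
    apply/JrightP => y; pose z := lmulJ (toA s) (rmulJ y (toA s^-1%g)).
    have := Jright_mul z Jx2; rewrite l2E => <-; congr (l' _); apply: jA_inj.
    rewrite jA_lmulJ jA_rmulJ !jA_mulJ !jA_lmulJ !jA_rmulJ -!mulrA.
    by rewrite toAVl mulr1.
  have Pg' : (tunit 1 x ^ s)%g \in Glam p' by rewrite gsE Glam_tunit group1.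
  have := agree Pg Pg'; rewrite gsE !xiE ?group1 // !lin_char1 //
    !mul1r -l2E => lx.
  have -> : (l - l2) x = l x - l2 x :> k by rewrite !lfunE /= !lfunE.
  by rewrite addcharD lx -addcharD subrr addchar0.
have pN y : pr (1 + jA y) = hA 1%g by rewrite kHprojD kHproj_jA addr0.
have [b1 Gb1 b1E] := triG_unit (pN (- y1));
  have [b2 Gb2 b2E] := triG_unit (pN y2).
have b12 : lmulD (toA b1) l = lmulD (toA b2) l2.
  have rN y x : rmulJ x (1 + jA y) = x + mulJ x y.
    by apply: jA_inj; rewrite jA_rmulJ jAD jA_mulJ mulrDr mulr1.
  apply/lfunP => x; rewrite (lmulDE _ l) (lmulDE _ l2) b1E b2E !rN.
  rewrite (Defs.formD l) (Defs.formD l2).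
  have -> : mulJ x (- y1) = - mulJ x y1.
    by apply/eqP; rewrite -addr_eq0 -mulJDr addNr mulJ0.
  have := E x; have -> : (l - l2) x = l x - l2 x :> k by rewrite !lfunE /=
    !lfunE.
  have -> : l (- mulJ x y1) = - l (mulJ x y1) :> k by rewrite linearN.
  have rearr (a b c d : k^o) : a - b = c + d -> a - c = b + d.
    by move/eqP; rewrite subr_eq => /eqP->;
      rewrite addrC addrA addrA addNr add0r addrC.
  exact: rearr.
exists (b2^-1 * b1)%g; rewrite groupM ?groupV //; split=> //.
  rewrite toAM kHprojM b1E pN hA1 mulr1.
  by have := congr1 pr (toAVl b2); rewrite kHprojM b2E pN hA1 mulr1.
by rewrite toAM lmulDA b12 -lmulDA toAVl lmulD1.
Qed.

(** [b l = s l' s^-1] rewrites as [(b^-1 s) l' = l s], and [b] has projection 1. *)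
Lemma twisted_orbit : l' \in orbit (twin_action (bimodD D)) (twin 1) l.
Proof.
have [b [Gb pb E]] := twisted_form.
apply/twin_orbitP; exists (b^-1 * s)%g, s; rewrite groupM ?groupV //;
  split=> //=.
  have pbV : pr (toA b^-1%g) = 1.
    by have := congr1 pr (toAVl b); rewrite kHprojM pb mulr1.
  by rewrite toAM kHprojM pbV mul1r.
have -> : l = lmulD (toA b^-1%g) l2 by rewrite -E -lmulDA toAVl lmulD1.
rewrite !lrmulD toAM lmulDA; congr lmulD.
by rewrite -rmulDA toAVl rmulD1.
Qed.

(** The idea is to evaluate the agreement at [h]. The conjugate [h ^ s] equals [h + x'], and it must
    be shown that [x'] lies in [Jright l'] and [l' x' = 0]. As [b] acts on the left, [l2 = b l]
    inherits [l2 h = l2], so [l'] is fixed on the right by both [h ^ s] and [h], hence [l' x' = 0]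
    as a form on [J]. *)
Lemma twisted_theta h : h \in Hfix (dp_idem p) -> h \in Hfix (dp_idem p') ->
  theta h = theta' h.
Proof.
move=> Hh Hh'; have [b [Gb pb E]] := twisted_form.
have fixl (q : dual_point D) : h \in Hfix (dp_idem q) ->
    rmulD (dp_form q) (hA h) = dp_form q.
  case: q => e f He fe /= Hq; apply/lfunP => x;
    rewrite rmulDE -(dual_lacth x He fe Hq).
  by congr (f _); apply: jA_inj; rewrite jA_lmulJ hA_jA.
have l2h : rmulD l2 (hA h) = l2 by rewrite -E lrmulD fixl.
pose X := toA (tunit h 0 ^ s)%g.
have l'X : rmulD l' X = l'.
  have -> : X = toA s^-1%g * hA h * toA s.
    by rewrite /X conjgE !toAM toA_tunit addr0 mulrA.
  have := congr1 (fun f => rmulD (lmulD (toA s^-1%g) f) (toA s)) l2h.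
  rewrite /l2 !lrmulD -!lmulDA toAVl !lmulD1 -!rmulDA -mulrA toAVl rmulD1.
  by rewrite mulrA.
have [t0 pt0] := triG_proj Gs.
have [j sE] := hpart_proj Gs pt0.
pose n := tunit 1 (lacth t0^-1%g j).
have snE : s = (tunit t0 0 * n)%g.
  rewrite sE tunitM mulg1 mul0J addr0 racth0 addr0; congr tunit.
  by have := td_lactM t0 t0^-1%g j; rewrite mulgV td_lact1.
have XE : toA n^-1%g * (hA h * toA n) = X.
  have hE : (tunit h 0 ^ tunit t0 0)%g = tunit h 0 :> U.
    rewrite conjgE !tunitM !(lacth0, racth0, mul0J) !addr0.
    apply/eqP; rewrite -(inj_eq (mulgI (tunit t0 0))) mulKVg tunitM.
    rewrite !(lacth0, racth0, mul0J) !addr0; apply/eqP; congr tunit.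
    by have /centsP := td_abelian D; apply; rewrite inE.
  by rewrite /X snE conjgM hE conjgE !toAM toA_tunit addr0.
(* With [s = t0 n] and [n = 1 + z], where [t0] commutes with [h], the difference [X - h] equals
   [n^-1 (h z - z h) = X y - y h] for [y = n^-1 z]. In this form the invariance of [l'] makes its
   value vanish. *)
pose y := lmulJ (toA n^-1%g) (lacth t0^-1%g j).
pose x' := lmulJ X y - rmulJ y (hA h).
have gsE : (tunit h 0 ^ s)%g = tunit h x'.
  apply: toA_inj; rewrite toA_tunit -/X jAB jA_lmulJ jA_rmulJ jA_lmulJ.
  set z := jA (lacth _ _); have nE : toA n = 1 + z by rewrite toA_tunit hA1.
  rewrite -{2}XE -!mulrA [toA n * _]mulrA toAV mul1r -mulrBr.
  have -> : hA h * z - z * hA h = hA h * toA n - toA n * hA h.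
    by rewrite nE mulrDr mulrDl mulr1 mul1r opprD addrACA subrr add0r.
  by rewrite mulrBr XE mulrA toAVl mul1r addrC subrK.
have lh z : l' (lmulJ (hA h) z) = l' z.
  by rewrite -[RHS](congr1 (fun f : Jd => f z) (fixl p' Hh')) rmulDE.
have lX z : l' (lmulJ X z) = l' z.
  by rewrite -[RHS](congr1 (fun f : Jd => f z) l'X) rmulDE.
have Pg : tunit h 0 \in Glam p.
  by rewrite Glam_tunit Hh; apply/JrightP => z; rewrite mul0J linear0.
have Jx' : x' \in Jright l'.
  apply/JrightP => z; have -> : mulJ x' z = lmulJ X z - lmulJ (hA h) z.
    apply: jA_inj; rewrite jA_mulJ jAB !jA_lmulJ -mulrBl; congr (_ * _).
    have : toA (tunit h 0 ^ s)%g = hA h + jA x' by rewrite gsE.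
    by rewrite -/X => ->; rewrite addrC addKr.
  by rewrite dualB lX lh subrr.
have Pg' : (tunit h 0 ^ s)%g \in Glam p' by rewrite gsE Glam_tunit Hh'.
have l'x' : l' x' = 0.
  rewrite /x' dualB lX.
  have -> : rmulJ y (hA h) = racth y h by apply: jA_inj; rewrite jA_rmulJ jA_hA.
  by rewrite (dual_racth y (dp_idemP p') (dp_formP p') Hh') subrr.
have := agree Pg Pg'; rewrite gsE !xiE //; last by move: Pg;
  rewrite Glam_tunit => /andP[].
by rewrite l'x' linear0 addchar0 !mulr1.
Qed.

End Overlap.
End Supercharacters.

(** * Disjointness of the indexed supercharacters *)

Section Disjointness.
Variables (k : finFieldType) (hT : finGroupType) (D : triangular_data k hT).
Variable eps : nontrivial_addchar k.
Implicit Types a : indexA D.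

Definition index_point a : dual_point D :=
  DualPoint (indexA_idem a) (indexA_form a).

Definition index_char a : 'CF(Hfix (dp_idem (index_point a))) :=
  'chi_(tagged (val a)).1.

Lemma index_char_lin a : index_char a \is a linear_char.
Proof. by case/and3P: (valP a). Qed.

Lemma indexA_orbit a (l := xchoose (indexA_inh a)) :
  regular (bimodD D) (tag (val a)) l /\
  (tagged (val a)).2 = orbit (twin_action (bimodD D)) (twin (tag (val a))) l.
Proof.
have He := indexA_idem a; have wl : l \in (tagged (val a)).2 :=
  xchooseP (indexA_inh a).
have /and3P[_ _ /(regular_orbJdualP _ He)[l0 R0 wE]] := valP a.
have C0 : l0 \in corner (bimodD D) (tag (val a)) by case/andP: R0.
have /setIP[l0l Cl] : l \in orbit (twin_action (bimodD D)) (twin 1) l0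
    :&: corner (bimodD D) (tag (val a)).
  by rewrite -corner_orbit // -wE.
split; first exact: regular_orbit R0 l0l Cl.
by rewrite wE; apply/orbit_eqP; rewrite orbit_sym -wE.
Qed.

Lemma chi_indexE a : chi_index eps a = chi_point eps (index_char a).
Proof. by []. Qed.

(** Stated for arbitrary dependent pairs so that, once the idempotents are known to be equal, one
    can be substituted for the other and the characters become comparable on one group. *)
Lemma indexA_data_eq (d d' : {e : triA D & (Iirr (Hfix e) * {set triJdual
  D})%type})
    (l l' : triJdual D) :
  tag d \in idemH D -> tag d' \in idemH D ->
  regular (bimodD D) (tag d) l -> regular (bimodD D) (tag d') l' ->
  (tagged d).2 = orbit (twin_action (bimodD D)) (twin (tag d)) l ->
  (tagged d').2 = orbit (twin_action (bimodD D)) (twin (tag d')) l' ->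
  l' \in orbit (twin_action (bimodD D)) (twin 1) l ->
  (forall h, h \in Hfix (tag d) -> h \in Hfix (tag d') ->
     'chi_(tagged d).1 h = 'chi_(tagged d').1 h) ->
  d = d'.
Proof.
case: d d' => [e [i w]] [e' [i' w']] /= He He' Rl Rl' -> -> ll' thE.
have ee' := regular_uniq He He' Rl Rl' ll'; subst e'.
have -> : i = i' by apply/irr_inj/cfun_inP => h Hh; apply: thE.
have Cl : l \in corner (bimodD D) e by case/andP: Rl.
have -> // : orbit (twin_action (bimodD D)) (twin e) l
  = orbit (twin_action (bimodD D)) (twin e) l'.
have Cl' : l' \in corner (bimodD D) e by case/andP: Rl'.
by apply/orbit_eqP; rewrite corner_orbit // in_setI Cl orb_sym ll'.
Qed.

(** A nonzero inner product yields an [s] where the inducing characters agree; then [twisted_orbit]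
    and [twisted_theta] identify the two indices. *)
Lemma chi_index_ortho a a' : a != a' -> '[chi_index eps a, chi_index eps a'] =
  0.
Proof.
move=> neq_aa'; apply/eqP/negPn/negP => nz; case/eqP: neq_aa'.
have [s Gs agree] := cfdot_Ind_lin_neq0 (Glam_sub _) (Glam_sub _)
  (xi_lin eps (index_char_lin a)) (xi_lin eps (index_char_lin a')) nz.
have ll' := twisted_orbit (index_char_lin a) (index_char_lin a') Gs agree.
have thE := twisted_theta (index_char_lin a) (index_char_lin a') Gs agree.
have [Rl wE] := indexA_orbit a; have [Rl' wE'] := indexA_orbit a'.
apply: val_inj.
exact: indexA_data_eq (indexA_idem a) (indexA_idem a') Rl Rl' wE wE' ll' thE.
Qed.

Lemma chi_index_char a : chi_index eps a \is a character /\ chi_index eps a !=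
  0.
Proof. exact: chi_point_char (index_char_lin a). Qed.

Lemma chi_index_disjoint a a' : a != a' ->
  disjoint_characters (chi_index eps a) (chi_index eps a').
Proof.
move=> neq_aa' i [ia ia']; have := chi_index_ortho neq_aa'.
move/(constt_ortho_char (proj1 (chi_index_char a)) (proj1 (chi_index_char a'))
  ia ia').
by move/eqP; rewrite cfnorm_irr oner_eq0.
Qed.

Lemma chi_index_superclass a (b : indexB D) :
  {in Kclass b &, forall g g', chi_index eps a g = chi_index eps a g'}.
Proof.
have [e [h [y [_ _ ->]]]] := KclassE b => g g' Kg Kg'.
have Gt : tunit h y \in triG D by apply: imset2_f.
rewrite !chi_indexE (chi_point_superclass eps (index_char_lin a) Gt Kg).
by rewrite (chi_point_superclass eps (index_char_lin a) Gt Kg').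
Qed.

End Disjointness.

Theorem theorem4p5 (k : finFieldType) (hT : finGroupType)
    (D : triangular_data k hT) (eps : nontrivial_addchar k) :
  supercharacter_theory (triG_group D)
    (fun a : indexA D => chi_index eps a) (fun b : indexB D => Kclass b).
Proof.
split.
- by split=> [a|a a']; [apply: chi_index_char | apply: chi_index_disjoint].
- exact: partition_Kclass.
- exact: card_indexAB eps.
- exact: chi_index_superclass.
- exact: Kclass_one.
Qed.
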